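(* There exists a positive constant $u$ such that for all real $X\ge2$, $$\#\{n\le X: n \text{ is } \lambda^\star\text{-practical}\}\le u\,\frac{X}{\log X}.$$
   Context: $\lambda$ is the Carmichael function. A positive integer $n$ is $\lambda^\star$-practical if every positive integer $m\le\sum_{d\mid n}\lambda(d)$ can be written as $\sum_{d\in\mathcal{D}}\lambda(d)$ for some set $\mathcal{D}$ of distinct positive divisors of $n$. *)

(* Defs.v *)
From mathcomp Require Import all_boot all_order all_algebra.
Set Implicit Arguments. Unset Strict Implicit. Unset Printing Implicit Defensive.

(* Carmichael function: lambda(n) = least m >= 1 with a^m = 1 (mod n)
   for every a coprime to n.  Since lambda(n) <= totient n <= n for n >= 1,
   searching m in 1..n suffices.  lambda(1) = 1; lambda(0) = 0 (unused). *)
Definition carmichael_ok (n m : nat) : bool :=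
  all (fun a => coprime a n ==> (a ^ m == 1 %[mod n])) (iota 0 n).

Definition carmichael (n : nat) : nat :=
  head 0 [seq m <- iota 1 n | carmichael_ok n m].

Definition sum_lambda_div (n : nat) : nat :=
  \sum_(d <- divisors n) carmichael d.

(* n is lambda*-practical: every positive m <= sum_{d|n} lambda(d) is a sum of
   lambda(d) over a set of distinct divisors d of n (a subsequence of the
   duplicate-free list of divisors). *)
Definition lambda_star_practical (n : nat) : Prop :=
  0 < n /\
  forall m, 0 < m -> m <= sum_lambda_div n ->
    exists D : seq nat, subseq D (divisors n) /\ \sum_(d <- D) carmichael d = m.

(* Main.v *)
Require Import Defs.
From mathcomp Require Import all_boot all_order all_algebra.
From mathcomp Require Import all_classical all_reals all_analysis.
From mathcomp Require Import cyclic zify ring lra.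
Set Implicit Arguments. Unset Strict Implicit. Unset Printing Implicit Defensive.
Import Order.TTheory GRing.Theory Num.Theory.

(**
If p | n is prime then every divisor d of n with a prime factor >= p has
lambda(d) >= p - 1, while the other divisors divide the part m of n made of the
primes < p and their lambda's add up to at most m. Hence a lambda*-practical n
is "chained": p <= m + 2 for every prime p | n. It remains to count the set B of
chained numbers.

Every n >= 1 factors uniquely as b r with b in B and all primes of r above b + 2.
For a completely multiplicative f, summing f over the Q-smooth n gives the
identity
  sum_(b in B, b Q-smooth) h_b = 1,  h_b = f(b) prod_(p <= min(b + 2, Q)) (1 - f(p)).
Write h_b(s) for f(n) = n^-s. Since sum_(p <= x) ln p / (p - 1) <= ln x + O(1),
the ratio h_b(1 + d) / h_b(1) is at most exp(O(d)) for all b, and at most 1/2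
once d ln b >= 16; comparing the identities at s = 1 and s = 1 + d yields
  sum_(b > y) h_b(1) = O(1 / ln y).
Comparing s = 1 with s = 1 - 1 / (4 ln Q) improves this for Q-smooth b to
  sum_(b in B, b Q-smooth, b > y) 1/b = O((ln Q / ln y)^2).
Finally a chained n > sqrt N is m p with p its largest prime, m in B and
ln m >= (ln N) / 8, so Chebyshev's bound for the sum of ln p over p <= N / m
bounds the count by O(N) times the sum of 1 / (m ln P(m)), P(m) being the largest
prime of m; partial summation over P(m) shows that this sum is O(1 / ln N).
*)

(** * Practical numbers are chained *)

(** By Euler's theorem [totient d] passes the filter, and it lies in the search range. So the
    filtered list is nonempty and, being sorted, has its minimum at the head. *)
Lemma carmichaelP (d : nat) : 0 < d ->
  [/\ 0 < carmichael d, carmichael_ok d (carmichael d)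
    & carmichael d <= totient d].
Proof.
move=> d_gt0; set s := [seq m <- iota 1 d | carmichael_ok d m].
have tot_in : totient d \in s.
  rewrite mem_filter mem_iota totient_gt0 d_gt0 add1n ltnS; apply/andP; split.
    by apply/allP => a _; apply/implyP => co; rewrite Euler_exp_totient.
  rewrite totient_count_coprime big_mkord -[leqRHS]card_ord -sum1_card.
  by apply: leq_sum => i _; case: (coprime d i).
have s_sorted : sorted leq s by apply: (sorted_filter leq_trans); apply: iota_sorted.
have ne : s != [::] by case: (s) tot_in.
have head_in : carmichael d \in s by rewrite /carmichael -/s; case: (s) ne => //= a l _; rewrite mem_head.
move: (head_in); rewrite mem_filter mem_iota => /and3P[ok gt0 _]; split=> //.
rewrite /carmichael -/s; case: (s) s_sorted tot_in => //= a l /order_path_min => /(_ leq_trans)/allP h.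
by rewrite inE => /predU1P[->//|/h].
Qed.

Lemma carmichael_exp (d a : nat) : 0 < d -> coprime a d ->
  a ^ carmichael d = 1 %[mod d].
Proof.
move=> d_gt0 co; have [_ /allP ok _] := carmichaelP d_gt0.
rewrite -modnXm; apply/eqP.
by apply: (implyP (ok (a %% d) _)); rewrite ?mem_iota ?ltn_pmod ?coprime_modl.
Qed.

(* Units mod p lift to units mod d, so X^lambda(d) - 1 has p - 1 roots in F_p. *)
Lemma leq_pred_carmichael (p d : nat) : prime p -> p %| d -> 0 < d ->
  p.-1 <= carmichael d.
Proof.
move=> p_pr pd d_gt0; have [m_gt0 _ _] := carmichaelP d_gt0.
have -> : p.-1 = size (enum (predC1 (0%R : 'F_p))).
  by rewrite -cardE cardC1 card_Fp.
apply: max_unity_roots => //; last exact: enum_uniq.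
apply/allP => x; rewrite mem_enum /= => x0; rewrite unity_rootE.
(* [c] is [x] on the [p]-part of [d] and [1] on the rest. It is coprime to [d] yet still congruent
   to [x] mod [p], so [x] inherits the exponent [carmichael d]. *)
set c := chinese d`_p d`_p^' x 1.
have copp : coprime d`_p d`_p^' by rewrite coprime_partC.
have p_dp : p %| d`_p by rewrite p_part dvdn_exp // logn_gt0 mem_primes p_pr d_gt0.
have cE : (c = x %[mod p])%N.
  have h := chinese_modl copp x 1; rewrite -/c in h.
  by rewrite -(modn_dvdm c p_dp) h modn_dvdm.
have copx : coprime x p.
  rewrite coprime_sym prime_coprime // gtnNdvd //; last first.
    by rewrite -[ltnRHS](Fp_cast p_pr) ltn_ord.
  by rewrite lt0n; apply: contra x0 => /eqP x0; apply/eqP/val_inj.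
have coc : coprime c d.
  rewrite -(partnC p d_gt0) coprimeMr; apply/andP; split.
    have c_p : coprime c p by rewrite -coprime_modl cE coprime_modl.
    by rewrite p_part coprimeXr.
  by rewrite -coprime_modl /c chinese_modr // coprime_modl coprime1n.
have := carmichael_exp d_gt0 coc.
move/(congr1 (modn^~ p)); rewrite !modn_dvdm // -modnXm cE modnXm => /(congr1 (fun k => k%:R%R : 'F_p)).
by rewrite !Fp_nat_mod // GRing.natrX natr_Zp => ->.
Qed.

Definition below (p : nat) : nat_pred := [pred r | r < p].

Definition chained (n : nat) : bool :=
  (0 < n) && all (fun p => p <= n`_(below p) + 2) (primes n).

Lemma chainedP (n : nat) : reflect
  (0 < n /\ forall p, prime p -> p %| n -> p <= n`_(below p) + 2) (chained n).
Proof.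
apply: (iffP andP) => -[n_gt0 h]; split=> //.
  by move=> p p_pr pn; apply: (allP h); rewrite mem_primes p_pr n_gt0.
by apply/allP => p; rewrite mem_primes => /and3P[p_pr _ pn]; apply: h.
Qed.

(** Termwise, since [carmichael d <= totient d] and the totients of the divisors of [n] add up to
    [n]. *)
Lemma sum_carmichael_leq (n : nat) : 0 < n -> sum_lambda_div n <= n.
Proof.
move=> n_gt0; rewrite -[leqRHS]sum_totient_dvd /sum_lambda_div.
rewrite -(big_mkord (fun d => d %| n) totient).
have -> : \sum_(d <- divisors n) carmichael d
    = \sum_(0 <= d < n.+1 | d %| n) carmichael d.
  rewrite -[RHS]big_filter; apply: perm_big.
  apply: uniq_perm; [exact: divisors_uniq|exact/filter_uniq/iota_uniq|move=> d].
  rewrite mem_filter mem_index_iota -dvdn_divisors //= ltnS.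
  by case dn: (d %| n); rewrite // dvdn_leq.
rewrite big_nat_cond [leqRHS]big_nat_cond.
apply: leq_sum => d /andP[_ /dvdn_gt0 h].
by have [] := carmichaelP (h n_gt0).
Qed.

Lemma practical_chained (n : nat) : lambda_star_practical n -> chained n.
Proof.
move=> [n_gt0 prac]; apply/chainedP; split=> // p p_pr pn.
rewrite leqNgt; apply/negP => lt_p; set m := n`_(below p) in lt_p.
have m_gt0 : 0 < m by rewrite part_gt0.
have sm := sum_carmichael_leq m_gt0.
have lam_ge d : d \in divisors n -> ~~ (d %| m) -> p.-1 <= carmichael d.
  rewrite -dvdn_divisors // => dn ndm; have d_gt0 := dvdn_gt0 n_gt0 dn.
  have /allPn[r] : ~~ all (mem (below p)) (primes d).
    apply: contra ndm => h; have dpi : (below p).-nat d by rewrite /pnat d_gt0.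
    by rewrite -(part_pnat_id dpi) partn_dvd.
  rewrite mem_primes => /and3P[r_pr _ rd]; rewrite !inE -leqNgt => pr.
  by apply: leq_trans (leq_pred_carmichael r_pr rd d_gt0); rewrite -!subn1 leq_sub2r.
have pdiv : p \in divisors n by rewrite -dvdn_divisors.
have pm : ~~ (p %| m).
  apply/negP => pm; have := part_pnat (below p) n.
  move/andP=> [_ /allP/(_ p)]; rewrite mem_primes p_pr part_gt0 pm => /(_ isT).
  by rewrite !inE ltnn.
(* The unreachable value: it is at most [m + 1 < p - 1], too small for any divisor of [n] not
   dividing [m], while the divisors of [m] fall short by one. The divisor [p] alone puts it in
   range. *)
have [||D [sD eD]] := prac (sum_lambda_div m).+1; first by [].
  rewrite {2}/sum_lambda_div (big_rem p) //=.
  have := lam_ge p pdiv pm; have := prime_gt1 p_pr; lia.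
have D_dvd d : d \in D -> d %| m.
  move=> dD; apply/negPn/negP => /(lam_ge d (mem_subseq sD dD)).
  move: eD; rewrite (big_rem d) //=; lia.
have : \sum_(d <- D) carmichael d <= sum_lambda_div m.
  apply: (uniq_sub_le_big leqnn (fun i j => leq_addr j i)); rewrite ?divisors_uniq //.
  - by apply: subseq_uniq sD (divisors_uniq n).
  - by move=> d dD; rewrite -dvdn_divisors // D_dvd.
by rewrite eD ltnn.
Qed.

(** * Unique factorization into a chained part and a rough part *)

Definition above (k : nat) : nat_pred := [pred r | k < r].

Lemma chained_gt0 (n : nat) : chained n -> 0 < n.
Proof. by case/andP. Qed.

Lemma pnat_prime_in (pi : nat_pred) (n p : nat) :
  pi.-nat n -> prime p -> p %| n -> p \in pi.
Proof. by case/andP=> n_gt0 /allP h p_pr pn; apply: h; rewrite mem_primes p_pr n_gt0. Qed.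

(** If [n] is not chained, cut it at the least prime [p] that breaks the condition: the part [b]
    below [p] is chained by minimality, and all other primes are at least [p > b + 2]. *)
Lemma chained_factor (n : nat) : 0 < n ->
  exists b r, [/\ n = b * r, chained b & (above b.+2).-nat r].
Proof.
move=> n_gt0; case: (boolP (chained n)) => [nB|].
  by exists n, 1; rewrite muln1.
rewrite /chained n_gt0 /= => /allPn[p0]; rewrite mem_primes => /and3P[p0_pr _ p0n].
rewrite -ltnNge => lt_p0.
pose P p := [&& prime p, p %| n & n`_(below p) + 2 < p].
have exP : exists p, P p by exists p0; rewrite /P p0_pr p0n.
case: (ex_minnP exP) => p /and3P[p_pr pn lt_p] min_p.
exists n`_(below p), n`_(below p)^'; split; first by rewrite partnC.
  apply/chainedP; split=> [|q q_pr qb]; first exact: part_gt0.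
  have lt_qp : q < p by apply: (pnat_prime_in (part_pnat (below p) n)).
  rewrite partn_part; last by move=> r; rewrite !inE => /ltn_trans; apply.
  rewrite leqNgt; apply/negP => lt_q; have := min_p q.
  rewrite /P q_pr lt_q (dvdn_trans qb (dvdn_part _ _)) => /(_ isT).
  by rewrite leqNgt lt_qp.
apply: sub_in_pnat (part_pnat (below p)^' n) => q _.
by rewrite !inE -leqNgt; apply: leq_trans; rewrite -addn2.
Qed.

Lemma pnat_below_above (k l n : nat) : k <= l.+1 -> (above l).-nat n -> n`_(below k) = 1.
Proof.
move=> le_kl n_l; apply: part_p'nat; apply: sub_in_pnat n_l => q _.
by rewrite !inE -leqNgt; apply: leq_trans.
Qed.

Lemma chained_pnat (b : nat) : chained b -> (below b.+3).-nat b.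
Proof.
case/chainedP=> b_gt0 h; rewrite /pnat b_gt0 /=; apply/allP => p.
rewrite mem_primes inE ltnS => /and3P[p_pr _ pb].
by apply: leq_trans (h p p_pr pb) _; rewrite addn2 !ltnS dvdn_leq // dvdn_part.
Qed.

(** With [b <= b'], the part of [b'] below [b + 3] must be [b]. If [b'] had further primes, the
    least of them would be at least [b + 3] with only [b] below it, breaking the chain. *)
Lemma chained_factor_uniq (b r b' r' : nat) :
  chained b -> chained b' -> (above b.+2).-nat r -> (above b'.+2).-nat r' ->
  b * r = b' * r' -> b = b'.
Proof.
wlog le_bb : b r b' r' / b <= b' => [IH|].
  move=> bB b'B rA r'A E; case: (leqP b b') => [le_bb|/ltnW le_bb].
    exact: IH bB b'B rA r'A E.
  by apply/esym/(IH _ _ _ _ le_bb b'B bB r'A rA); rewrite E.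
move=> bB b'B rA r'A E.
have b_gt0 := chained_gt0 bB; have b'_gt0 := chained_gt0 b'B.
have r_gt0 : 0 < r by case/andP: rA.
have r'_gt0 : 0 < r' by case/andP: r'A.
have Eb : b'`_(below b.+3) = b.
  have := congr1 (partn^~ (below b.+3)) E; rewrite /= !partnM //.
  rewrite (pnat_below_above (leqnn _) rA) (pnat_below_above _ r'A) //.
  by rewrite !muln1 (part_pnat_id (chained_pnat bB)).
have [E1|ne1] := eqVneq b'`_(below b.+3)^' 1.
  by rewrite -(partnC (below b.+3) b'_gt0) Eb E1 muln1.
set c := b'`_(below b.+3)^' in ne1.
have c_gt1 : 1 < c by rewrite ltn_neqAle eq_sym ne1 part_gt0.
have p_pr := pdiv_prime c_gt1; set p := pdiv c in p_pr.
have le_p : b.+3 <= p.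
  have := pnat_prime_in (part_pnat (below b.+3)^' b') p_pr (pdiv_dvd _).
  by rewrite !inE -leqNgt.
have pb' : p %| b' by apply: dvdn_trans (pdiv_dvd _) (dvdn_part _ _).
case/chainedP: b'B => _ /(_ p p_pr pb').
suff -> : b'`_(below p) = b by rewrite addn2 leqNgt le_p.
rewrite -Eb; apply: eq_in_partn => q; rewrite mem_primes => /and3P[q_pr _ qb'].
rewrite !inE; apply/idP/idP => [lt_qp|lt_q]; last exact: leq_trans lt_q le_p.
rewrite ltnNge; apply/negP => le_q.
have qc : q %| c.
  have q_pi : (below b.+3)^'.-nat q by rewrite pnatE // !inE -leqNgt.
  by rewrite -(part_pnat_id q_pi) partn_dvd.
by move: lt_qp; rewrite ltnNge pdiv_min_dvd // prime_gt1.
Qed.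

(** For [q <= p] the factor [p] does not enter the part below [q], so [m] and [m * p] satisfy the
    same conditions there. This splits off a largest prime. *)
Lemma chained_mulr_prime (m p : nat) : prime p -> (below p.+1).-nat m ->
  chained (m * p) -> chained m /\ p <= m.+2.
Proof.
move=> p_pr m_p /chainedP[mp_gt0 h]; have p_gt0 := prime_gt0 p_pr.
have m_gt0 : 0 < m by case/andP: m_p.
have E q : q <= p -> (m * p)`_(below q) = m`_(below q).
  move=> le_q; rewrite partnM // [p`_ _]part_p'nat ?muln1 //.
  by rewrite pnatE // !inE -leqNgt.
split; last first.
  by have := h p p_pr (dvdn_mull _ (dvdnn _)); rewrite E // => /leq_trans; apply;
    rewrite addn2 !ltnS dvdn_leq // dvdn_part.
apply/chainedP; split=> // q q_pr qm; rewrite -E ?h ?dvdn_mulr //.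
by rewrite -ltnS; apply: (pnat_prime_in m_p).
Qed.

Local Open Scope ring_scope.

(** * Euler products *)

Definition between (lo hi : nat) : nat_pred := [pred p | (lo < p <= hi)%N].

Definition euler_weight (R : realType) (f : nat -> R) : Prop :=
  [/\ f 1%N = 1,
      forall m n, (0 < m)%N -> (0 < n)%N -> f (m * n)%N = f m * f n,
      forall n, 0 <= f n
    & forall p, prime p -> f p < 1].

(** Truncation at [Z] keeps all sums finite. The two inequalities below show that the limit in [Z]
    is [1 / euler_prod f lo hi]. *)
Definition smooth_sum (R : realType) (f : nat -> R) (lo hi Z : nat) : R :=
  \sum_(1 <= n < Z.+1 | (between lo hi).-nat n) f n.

Definition euler_prod (R : realType) (f : nat -> R) (lo hi : nat) : R :=
  \prod_(lo.+1 <= p < hi.+1 | prime p) (1 - f p).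

Lemma sum_multiples (R : realType) (d Z : nat) (P : pred nat) (F : nat -> R) :
  (0 < d)%N ->
  \sum_(1 <= n < Z.+1 | (d %| n)%N && P n) F n
  = \sum_(1 <= m < (Z %/ d).+1 | P (d * m)%N) F (d * m)%N.
Proof.
move=> d_gt0; rewrite -(big_map (muln d) P F) -big_filter_cond.
apply: perm_big; apply: uniq_perm.
- exact/filter_uniq/iota_uniq.
- by rewrite map_inj_uniq ?iota_uniq // => i j /eqP; rewrite eqn_pmul2l // => /eqP.
move=> n; rewrite mem_filter mem_index_iota; apply/andP/mapP.
  move=> [/dvdnP[m ->] /andP[n_gt0 n_le]]; exists m; last by rewrite mulnC.
  rewrite ltnS in n_le; rewrite mem_index_iota ltnS leq_divRL // n_le andbT.
  by case: m n_gt0 {n_le}.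
move=> [m]; rewrite mem_index_iota ltnS leq_divRL // => /andP[m_gt0 m_le] ->.
by rewrite dvdn_mulr // muln_gt0 d_gt0 m_gt0 ltnS mulnC.
Qed.

Lemma smooth_sum_ge0 (R : realType) (f : nat -> R) lo hi Z :
  euler_weight f -> 0 <= smooth_sum f lo hi Z.
Proof. by case=> _ _ f0 _; apply: sumr_ge0. Qed.

Lemma euler_prod_ge0 (R : realType) (f : nat -> R) lo hi :
  euler_weight f -> 0 <= euler_prod f lo hi.
Proof. by case=> _ _ _ f1; apply: prodr_ge0 => p /f1; lra. Qed.

Lemma smooth_sum_empty (R : realType) (f : nat -> R) lo hi Z :
  euler_weight f -> (hi <= lo)%N -> smooth_sum f lo hi Z = (0 < Z)%:R.
Proof.
case=> f1 _ _ _ le_hl; rewrite /smooth_sum.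
have E n : (0 < n)%N -> (between lo hi).-nat n = (n == 1%N).
  move=> n_gt0; apply/idP/eqP => [h|->]; last done.
  apply/eqP; rewrite -[n == _]negbK; apply/negP => n1.
  have n_gt1 : (1 < n)%N by rewrite ltn_neqAle eq_sym n1.
  have := pnat_prime_in h (pdiv_prime n_gt1) (pdiv_dvd n); rewrite inE => /andP[a b].
  by move: (leq_trans a (leq_trans b le_hl)); rewrite ltnn.
case: Z => [|Z]; first by rewrite big_geq.
rewrite big_ltn_cond // f1 big_nat_cond big1 ?addr0 // => n /andP[/andP[n_gt1 _]].
by rewrite E ?(ltnW n_gt1) // => /eqP n1; rewrite n1 in n_gt1.
Qed.

(** Split by divisibility by the new prime; a multiple is that prime times a number of the same kind
    up to [Z %/ hi.+1]. *)
Lemma smooth_sum_prime (R : realType) (f : nat -> R) lo hi Z :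
  euler_weight f -> (lo <= hi)%N -> prime hi.+1 ->
  smooth_sum f lo hi.+1 Z = smooth_sum f lo hi Z + f hi.+1 * smooth_sum f lo hi.+1 (Z %/ hi.+1).
Proof.
move=> [_ fM _ _] le_lh p_pr; rewrite /smooth_sum (bigID (fun n => hi.+1 %| n)%N) /= addrC.
congr (_ + _).
  rewrite big_nat_cond [RHS]big_nat_cond; apply: eq_bigl => n.
  case n_gt0: (0 < n)%N => //=; case: (n < Z.+1)%N => //=.
  apply/andP/idP => [[n_p ndv]|n_h].
    apply: sub_in_pnat n_p => q; rewrite mem_primes => /and3P[_ _ qn].
    rewrite !inE => /andP[-> /=]; rewrite leq_eqVlt => /predU1P[Eq|//].
    by rewrite -Eq qn in ndv.
  split; first by apply: sub_in_pnat n_h => q _; rewrite !inE => /andP[-> /leqW ->].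
  by apply/negP => /(pnat_prime_in n_h p_pr); rewrite inE ltnn andbF.
under eq_bigl => n do rewrite andbC.
rewrite sum_multiples // mulr_sumr big_nat_cond [RHS]big_nat_cond.
apply: eq_big => m.
  case: (1 <= m < _)%N => //=; rewrite pnatM; case: (_.-nat m); rewrite ?andbF // andbT.
  by rewrite pnatE // inE ltnS le_lh leqnn.
by case/andP=> /andP[m_gt0 _] _; rewrite fM.
Qed.

Lemma euler_prodS (R : realType) (f : nat -> R) lo hi : (lo <= hi)%N ->
  euler_prod f lo hi.+1 = euler_prod f lo hi * (if prime hi.+1 then 1 - f hi.+1 else 1).
Proof.
move=> le_lh; rewrite /euler_prod big_mkcond big_nat_recr //= -big_mkcond //.
Qed.

Lemma smooth_sum_nprime (R : realType) (f : nat -> R) lo hi Z :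
  ~~ prime hi.+1 -> smooth_sum f lo hi.+1 Z = smooth_sum f lo hi Z.
Proof.
move=> np; apply: eq_bigl => n; apply: eq_in_pnat => q.
rewrite mem_primes => /andP[q_pr _]; rewrite !inE; congr (_ && _).
rewrite leq_eqVlt; case: eqP => // Eq; by rewrite -Eq q_pr in np.
Qed.

Lemma euler_prod_empty (R : realType) (f : nat -> R) lo hi : (hi <= lo)%N -> euler_prod f lo hi = 1.
Proof. by move=> le_hl; rewrite /euler_prod big_geq. Qed.

(** Double induction on [hi] and [Z]: with [a = f p], the recursion at a new prime [p] bounds the
    product by [(1 - a) + a = 1]. *)
Lemma smooth_sum_euler_prod_le1 (R : realType) (f : nat -> R) lo hi Z :
  euler_weight f -> smooth_sum f lo hi Z * euler_prod f lo hi <= 1.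
Proof.
move=> fW; have base h : (h <= lo)%N -> smooth_sum f lo h Z * euler_prod f lo h <= 1.
  by move=> le_hl; rewrite smooth_sum_empty // euler_prod_empty // mulr1; case: (0 < Z)%N.
elim: hi Z base => [|hi IH] Z base; first exact: base.
have [/base//|] := leqP hi.+1 lo; rewrite ltnS => le_lh; rewrite euler_prodS //.
case: ifP => [p_pr|/negbT np]; last first.
  by rewrite mulr1 smooth_sum_nprime // IH // => h le; rewrite smooth_sum_empty // euler_prod_empty // mulr1; case: (0 < Z)%N.
have {}IH Z' : smooth_sum f lo hi Z' * euler_prod f lo hi <= 1.
  by apply: IH => h le; rewrite smooth_sum_empty // euler_prod_empty // mulr1; case: (0 < Z')%N.
case: (fW) => _ _ f0 f1; have := f1 _ p_pr; have := f0 hi.+1; set a := f hi.+1 => a0 a1.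
elim/ltn_ind: Z {base} => Z IHZ.
rewrite smooth_sum_prime // -/a.
have [->|Z_gt0] := posnP Z.
  by rewrite div0n /smooth_sum !big_geq // mulr0 addr0 mul0r.
have := IHZ _ (ltn_Pdiv (prime_gt1 p_pr) Z_gt0); have := IH Z.
set x := smooth_sum _ _ _ _; set y := smooth_sum _ _ _ _; set P := euler_prod _ _ _ => h1 h2.
have -> : (x + a * y) * (P * (1 - a)) = (x * P) * (1 - a) + a * (y * (P * (1 - a))) by ring.
have h3 : (x * P) * (1 - a) <= 1 - a by rewrite ler_piMl // subr_ge0 ltW.
have h4 : a * (y * (P * (1 - a))) <= a by rewrite ler_piMr.
lra.
Qed.

Lemma exists_expr_le (R : realType) (a e : R) : 0 <= a -> a < 1 -> 0 < e ->
  exists k, a ^+ k <= e.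
Proof.
move=> a0 a1 e0; have := @cvg_expr R a; rewrite ger0_norm // => /(_ a1) /cvgrPdist_le /(_ e e0).
case=> k _ /(_ k (leqnn k)) /=; rewrite sub0r normrN ger0_norm ?exprn_ge0 // => h.
by exists k.
Qed.

(** The threshold [Z0] is uniform in [lo]. This matters later, when [lo = b + 2] varies with the
    chained factor. *)
Lemma smooth_sum_euler_prod_ge (R : realType) (f : nat -> R) hi (e : R) :
  euler_weight f -> 0 < e ->
  exists Z0, forall lo Z, (Z0 <= Z)%N -> 1 - e <= smooth_sum f lo hi Z * euler_prod f lo hi.
Proof.
move=> fW; have base h lo Z : (0 < Z)%N -> (h <= lo)%N -> smooth_sum f lo h Z * euler_prod f lo h = 1.
  by move=> Z0 le_hl; rewrite smooth_sum_empty // euler_prod_empty // mulr1 Z0.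
elim: hi e => [|hi IH] e e0.
  by exists 1%N => lo Z Z1; rewrite base //; lra.
case: (boolP (prime hi.+1)) => [p_pr|np]; last first.
  have [Z0 hZ] := IH e e0; exists (maxn Z0 1) => lo Z; rewrite geq_max => /andP[h1 h2].
  have [le|] := leqP hi.+1 lo; first by rewrite base //; lra.
  by rewrite ltnS => le; rewrite euler_prodS // (negbTE np) mulr1 smooth_sum_nprime // hZ.
case: (fW) => _ _ f0 f1; have := f1 _ p_pr; have := f0 hi.+1; set a := f hi.+1 => a0 a1.
have e2 : 0 < e / 2 by lra.
have [Z0 hZ] := IH _ e2; have [k hk] := exists_expr_le a0 a1 e2.
(* Room for [k] divisions by the new prime before the cutoff drops below [Z0]; unrolling the
   recursion [k] times leaves only the defect [a ^+ k <= e / 2]. *)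
exists (maxn 1 (Z0 * hi.+1 ^ k))%N => lo Z; rewrite geq_max => /andP[Z_gt0 le_Z].
have [le|] := leqP hi.+1 lo; first by rewrite base //; lra.
rewrite ltnS => le_lh; rewrite euler_prodS // p_pr -/a.
set P := euler_prod _ _ _; have P0 : 0 <= P by exact: euler_prod_ge0.
suff: (1 - e / 2) * (1 - a ^+ k) <= smooth_sum f lo hi.+1 Z * (P * (1 - a)).
  have := exprn_ge0 k a0; move: hk; set u := a ^+ k => hk u0 h; nra.
elim: k Z {hk Z_gt0} le_Z => [|k IHk] Z le_Z.
  rewrite expr0 subrr mulr0 !mulr_ge0 //; [exact: smooth_sum_ge0|lra].
rewrite smooth_sum_prime // -/a; have le_Z2 : (Z0 * hi.+1 ^ k <= Z %/ hi.+1)%N.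
  by rewrite leq_divRL // -mulnA -expnSr.
have := IHk _ le_Z2; have := hZ lo Z _; rewrite -/P.
have -> : (Z0 <= Z)%N by apply: leq_trans le_Z; rewrite leq_pmulr // expn_gt0.
move=> /(_ isT); rewrite exprS.
set x := smooth_sum _ _ _ _; set y := smooth_sum _ _ _ _; set u := a ^+ k => h1 h2.
have -> : (x + a * y) * (P * (1 - a)) = (x * P) * (1 - a) + a * (y * (P * (1 - a))) by ring.
have h3 : (1 - e / 2) * (1 - a) <= x * P * (1 - a) by rewrite ler_wpM2r // subr_ge0 ltW.
have h4 := ler_wpM2l a0 h2.
lra.
Qed.

(** * The identity for chained numbers *)

Definition smooth_chained (Q b : nat) : bool := chained b && (between 0 Q).-nat b.

(** The limiting share, under the weight [f], of the [Q]-smooth numbers whose chained factor is [b],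
    for [Q]-smooth chained [b]. *)
Definition chain_mass (R : realType) (f : nat -> R) (Q b : nat) : R :=
  f b * euler_prod f 0 (minn b.+2 Q).

(** Existence and uniqueness of the chained factor, phrased as a sum equal to [1] so that it can be
    inserted under another sum. *)
Lemma sum_chained_factor (R : realType) (n Z : nat) : (0 < n <= Z)%N ->
  \sum_(1 <= b < Z.+1 | (b %| n)%N && (chained b && (above b.+2).-nat (n %/ b)%N)) (1 : R) = 1.
Proof.
move=> /andP[n_gt0 n_le]; have [b [r [En bB rA]]] := chained_factor n_gt0.
have b_gt0 := chained_gt0 bB.
have b_in : b \in index_iota 1 Z.+1.
  rewrite mem_index_iota b_gt0 ltnS (leq_trans _ n_le) // dvdn_leq // En.
  exact: dvdn_mulr.
rewrite big_mkcond (bigD1_seq b) ?iota_uniq //= En dvdn_mulr // mulKn // bB rA /=.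
rewrite big1 ?addr0 // => b' ne_b; case: ifP => // /and3P[b'n b'B r'A].
case/eqP: ne_b; apply: (chained_factor_uniq b'B bB r'A rA).
by rewrite mulnC divnK.
Qed.

Lemma smooth_sum_chained (R : realType) (f : nat -> R) (Q Z : nat) :
  euler_weight f ->
  smooth_sum f 0 Q Z
  = \sum_(1 <= b < Z.+1 | smooth_chained Q b) f b * smooth_sum f b.+2 Q (Z %/ b).
Proof.
move=> [_ fM _ _].
transitivity (\sum_(1 <= n < Z.+1 | (between 0 Q).-nat n)
   \sum_(1 <= b < Z.+1 | (b %| n)%N && (chained b && (above b.+2).-nat (n %/ b)%N)) f n).
  rewrite [LHS]big_nat_cond [RHS]big_nat_cond; apply: eq_bigr => n /andP[n_bd _].
  rewrite -[LHS]mulr1 -(@sum_chained_factor R n Z) ?mulr_sumr; last by [].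
  by apply: eq_bigr => b _; rewrite mulr1.
rewrite (exchange_big_dep xpredT) //= [RHS]big_mkcond big_nat_cond [RHS]big_nat_cond.
apply: eq_bigr => b /andP[/andP[b_gt0 _] _].
under eq_bigl => n do rewrite andbCA.
rewrite sum_multiples //.
have E m : (between 0 Q).-nat (b * m)%N && (chained b && (above b.+2).-nat (b * m %/ b)%N)
   = smooth_chained Q b && (between b.+2 Q).-nat m.
  rewrite mulKn // pnatM /smooth_chained.
  have -> : (between b.+2 Q).-nat m = (between 0 Q).-nat m && (above b.+2).-nat m.
    apply/idP/andP => [h|[/andP[m_gt0 /allP h] /andP[_ /allP h']]].
      by split; apply: sub_in_pnat h => q _; rewrite !inE; lia.
    rewrite /pnat m_gt0; apply/allP => q qm; have := h q qm; have := h' q qm.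
    by rewrite !inE; lia.
  case: (chained b); rewrite ?andbF //=.
  by case: (_.-nat b); case: (_.-nat m).
under eq_bigl => m do rewrite E.
case: (smooth_chained Q b) => /=; last by rewrite big_pred0.
rewrite mulr_sumr big_nat_cond [RHS]big_nat_cond.
by apply: eq_bigr => m /andP[/andP[m_gt0 _] _]; rewrite fM.
Qed.

Lemma euler_prod_minn (R : realType) (f : nat -> R) (k Q : nat) :
  euler_prod f 0 Q = euler_prod f 0 (minn k Q) * euler_prod f k Q.
Proof.
have [le|/ltnW le] := leqP k Q; last by rewrite [X in _ * X]euler_prod_empty ?mulr1.
by rewrite /euler_prod -big_cat_nat.
Qed.

Lemma chain_mass_ge0 (R : realType) (f : nat -> R) (Q b : nat) :
  euler_weight f -> 0 <= chain_mass f Q b.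
Proof. by move=> fW; rewrite mulr_ge0 ?euler_prod_ge0 //; case: fW. Qed.

Lemma chain_mass_le1 (R : realType) (f : nat -> R) (Q Z : nat) :
  euler_weight f ->
  \sum_(1 <= b < Z.+1 | smooth_chained Q b) chain_mass f Q b <= 1.
Proof.
move=> fW; set S := (X in X <= 1).
have S0 : 0 <= S by apply: sumr_ge0 => b _; apply: chain_mass_ge0.
(* If [S > 1], the choice [e = (S - 1) / (2 * S)] makes [(1 - e) * S = (S + 1) / 2 > 1]. *)
suff h (e : R) : 0 < e -> (1 - e) * S <= 1.
  rewrite leNgt; apply/negP => S1; have := h ((S - 1) / (2 * S)).
  have -> : (1 - (S - 1) / (2 * S)) * S = (S + 1) / 2 by field; lra.
  have : 0 < (S - 1) / (2 * S) by rewrite divr_gt0; lra.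
  by move=> H /(_ H); lra.
move=> e0; have [Z0 hZ] := smooth_sum_euler_prod_ge Q fW e0.
(* The cutoff [Z * Z0.+1] leaves every [b <= Z] a cofactor range of length at least [Z0]; the terms
   with [b > Z] are dropped. *)
have := smooth_sum_euler_prod_le1 0 Q (Z * Z0.+1) fW; rewrite smooth_sum_chained // mulr_suml; apply: le_trans.
rewrite (@big_cat_nat _ _ _ Z.+1) //=; last by rewrite ltnS leq_pmulr.
rewrite -[X in X <= _]addr0 lerD //; last first.
  apply: sumr_ge0 => b _; rewrite !mulr_ge0 ?smooth_sum_ge0 ?euler_prod_ge0 //; by case: fW.
rewrite /S mulr_sumr [leLHS]big_nat_cond [leRHS]big_nat_cond.
apply: ler_sum => b /andP[/andP[b_gt0 b_le] _].
rewrite (euler_prod_minn f b.+2 Q) /chain_mass.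
have := hZ b.+2 ((Z * Z0.+1) %/ b)%N _.
have -> : (Z0 <= Z * Z0.+1 %/ b)%N.
  by rewrite leq_divRL // mulnC leq_mul.
move=> /(_ isT); set x := smooth_sum _ _ _ _; set y := euler_prod _ b.+2 _; set z := euler_prod _ _ _ => h.
have -> : f b * x * (z * y) = (x * y) * (f b * z) by ring.
by apply: ler_wpM2r => //; rewrite mulr_ge0 ?euler_prod_ge0 //; case: fW.
Qed.

Lemma chain_mass_ge (R : realType) (f : nat -> R) (Q : nat) (e : R) :
  euler_weight f -> 0 < e -> exists Z0, forall Z, (Z0 <= Z)%N ->
  1 - e <= \sum_(1 <= b < Z.+1 | smooth_chained Q b) chain_mass f Q b.
Proof.
move=> fW e0; have [Z0 hZ] := smooth_sum_euler_prod_ge Q fW e0; exists Z0 => Z /(hZ 0%N).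
move=> h; apply: le_trans h _; rewrite smooth_sum_chained // mulr_suml; apply: ler_sum => b _.
rewrite (euler_prod_minn f b.+2 Q) /chain_mass.
have := smooth_sum_euler_prod_le1 b.+2 Q (Z %/ b) fW.
set x := smooth_sum _ _ _ _; set y := euler_prod _ b.+2 _; set z := euler_prod _ _ _ => h.
have -> : f b * x * (z * y) = (x * y) * (f b * z) by ring.
by apply: ler_piMl => //; rewrite mulr_ge0 ?euler_prod_ge0 //; case: fW.
Qed.

(** * Chebyshev and Mertens estimates *)

Lemma prod_primes_dvd (a b N : nat) :
  (\prod_(a <= p < b | prime p && (p %| N)) p %| N)%N.
Proof.
have [le|lt] := leqP b a; first by rewrite big_geq // dvd1n.
have [d ->] : exists d, b = (a + d)%N by exists (b - a)%N; rewrite subnKC // ltnW.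
suff: (\prod_(a <= p < a + d | prime p && (p %| N)) p %| N)%N
   /\ (below (a + d)).-nat (\prod_(a <= p < a + d | prime p && (p %| N)) p)%N by case.
elim: d => [|d [dv nat_b]]; first by rewrite addn0 big_geq // dvd1n.
rewrite addnS; set c := (a + d)%N in dv nat_b *; have le_ac : (a <= c)%N by rewrite leq_addr.
rewrite big_mkcond big_nat_recr //= -big_mkcond /=; set P := (\prod_(_ <= _ < _ | _) _)%N in dv nat_b *.
have nat_b1 : (below c.+1).-nat P.
  by apply: sub_in_pnat nat_b => q _; rewrite !inE => /ltnW; rewrite ltnS.
case: ifP => [/andP[c_pr cN]|_]; last by rewrite muln1.
have co : coprime P c.
  by apply: pnat_coprime nat_b _; rewrite pnatE // !inE ltnn.
by split; [rewrite Gauss_dvd // dv cN|rewrite pnatM nat_b1 pnatE // !inE ltnSn].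
Qed.

(** The coefficient occurs twice in the expansion of [(1 + 1) ^ (2m + 1)]. *)
Lemma bin_odd_leq (m : nat) : ('C(m.*2.+1, m) <= 4 ^ m)%N.
Proof.
have E4 : (2 * 4 ^ m = 2 ^ m.*2.+1)%N.
  by rewrite -[4%N]/(2 ^ 2)%N -expnM (mul2n m) -expnS.
rewrite -(leq_pmul2l (isT : 0 < 2)%N) E4 -[X in (_ <= X ^ _)%N]/(1 + 1)%N expnDn.
have lt1 : (m < m.*2.+2)%N by lia.
have lt2 : (m.+1 < m.*2.+2)%N by lia.
rewrite (bigD1 (Ordinal lt1)) // (bigD1 (Ordinal lt2)) /=; last by rewrite -val_eqE /= neq_ltn ltnSn orbT.
have E : 'C(m.*2.+1, m.+1) = 'C(m.*2.+1, m).
  by rewrite -bin_sub; [congr 'C(_, _); lia|lia].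
by rewrite !exp1n !muln1 E addnA addnn mul2n leq_addr.
Qed.

Lemma prime_dvd_fact (p n : nat) : prime p -> (p %| n`!)%N -> (p <= n)%N.
Proof.
move=> p_pr; elim: n => [|n IH]; first by rewrite fact0 dvdn1 => /eqP E; rewrite E in p_pr.
by rewrite factS Euclid_dvdM // => /orP[/dvdn_leq->//|/IH/leqW].
Qed.

(** Erdős's argument: the primes in [[m + 2, 2m + 1]] all divide ['C(2m + 1, m)], which is at most
    [4 ^ m]; the smaller ones are handled by induction. *)
Lemma primorial_leq (n : nat) : (\prod_(1 <= p < n.+1 | prime p) p <= 4 ^ n)%N.
Proof.
elim/ltn_ind: n => n IH; case: (leqP n 2) => [|n_gt2].
  by case: n {IH} => [|[|[|//]]] _; rewrite /index_iota /= ?big_cons big_nil.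
have [n_odd|n_even] := boolP (odd n); last first.
  case: n n_gt2 IH n_even => // n n_gt2 IH n_even.
  rewrite big_mkcond big_nat_recr //= -big_mkcond ifF ?muln1.
    by apply: leq_trans (IH n (ltnSn n)) _; rewrite leq_exp2l.
  apply/negP => p_pr; have [E|] := even_prime p_pr; first by rewrite E in n_gt2.
  by rewrite (negbTE n_even).
pose m := n./2; have En : n = m.*2.+1 by rewrite -(odd_double_half n) n_odd.
have m_gt0 : (0 < m)%N by move: n_gt2; rewrite En; lia.
rewrite (@big_cat_nat _ _ _ m.+2) //=; last by rewrite En; lia.
have -> : (4 ^ n = 4 ^ m.+1 * 4 ^ m)%N by rewrite -expnD; congr (_ ^ _)%N; rewrite En; lia.
apply: leq_mul; first by apply: IH; rewrite En; lia.
apply: leq_trans (bin_odd_leq m); apply: dvdn_leq; first by rewrite bin_gt0; lia.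
have := prod_primes_dvd m.+2 n.+1 'C(m.*2.+1, m).
rewrite [X in (X %| _)%N -> _](_ : _ = \prod_(m.+2 <= p < n.+1 | prime p) p)%N //.
rewrite big_nat_cond [RHS]big_nat_cond; apply: eq_bigl => p.
case bd: (m.+2 <= p < n.+1)%N => //=; case p_pr: (prime p) => //=.
have le_m : (m <= m.*2.+1)%N by lia.
have : (p %| m.*2.+1`!)%N.
  by apply: dvdn_fact; rewrite prime_gt0 //=; move: bd; rewrite En; lia.
rewrite -(bin_fact le_m) !Euclid_dvdM // => /or3P[//|/(prime_dvd_fact p_pr)|/(prime_dvd_fact p_pr)];
  move: bd; lia.
Qed.

Lemma ln_le_subr1 (R : realType) (x : R) : 0 < x -> ln x <= x - 1.
Proof. by move=> x0; have := expR_ge1Dx (ln x); rewrite lnK // lerBrDl. Qed.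

Lemma lnn_ge0 (R : realType) (n : nat) : 0 <= ln (n%:R : R).
Proof. by case: n => [|n]; [rewrite ln0|rewrite ln_ge0 // ler1n]. Qed.

Lemma lnn_le (R : realType) (m n : nat) : (0 < m)%N -> (m <= n)%N ->
  ln (m%:R : R) <= ln n%:R.
Proof.
by move=> m0 le; rewrite ler_ln ?posrE ?ltr0n ?ler_nat // (leq_trans m0).
Qed.

Lemma ln2_ge_half (R : realType) : 1 / 2 <= ln (2 : R).
Proof.
have := @ln_le_subr1 R (2^-1); rewrite lnV ?posrE // => h.
by have {h} := h _; rewrite invr_gt0 ltr0n => /(_ isT); lra.
Qed.

Lemma ln_prodn (R : realType) (r : seq nat) (P : pred nat) (F : nat -> nat) :
  (forall i, P i -> (0 < F i)%N) ->
  \sum_(i <- r | P i) ln ((F i)%:R : R) = ln (\prod_(i <- r | P i) F i)%N%:R.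
Proof.
move=> F0; suff [] : (0 < \prod_(i <- r | P i) F i)%N /\
  \sum_(i <- r | P i) ln ((F i)%:R : R) = ln (\prod_(i <- r | P i) F i)%N%:R by [].
elim: r => [|i r [x0 IH]]; first by rewrite !big_nil ln1.
rewrite !big_cons; case: ifP => // Pi.
by rewrite muln_gt0 F0 // x0 natrM lnM ?posrE ?ltr0n ?F0 // IH.
Qed.

Lemma theta_le (R : realType) (n : nat) :
  \sum_(1 <= p < n.+1 | prime p) ln (p%:R : R) <= 3 * n%:R.
Proof.
rewrite (@ln_prodn R _ prime id) => [|p]; last exact: prime_gt0.
apply: (@le_trans _ _ (ln (4 ^ n)%N%:R)).
  by apply: lnn_le (primorial_leq n); apply: prodn_cond_gt0 => p; apply: prime_gt0.
rewrite natrX lnXn // -[leLHS]mulr_natr.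
by rewrite ler_wpM2r //; have := @ln_le_subr1 R 4; lra.
Qed.

(** For [k <= n] the logarithms of the primes dividing [k] sum to at most [ln n]. Summing over [k]
    and swapping counts each [p] at least [n / p - 1] times; the error is the Chebyshev sum, at most
    [3 * n]. *)
Lemma sum_lnp_divp_le (R : realType) (n : nat) : (0 < n)%N ->
  \sum_(1 <= p < n.+1 | prime p) ln (p%:R : R) / p%:R <= ln n%:R + 3.
Proof.
move=> n_gt0; have n0 : 0 < n%:R :> R by rewrite ltr0n.
have h1 : \sum_(1 <= k < n.+1) \sum_(1 <= p < n.+1 | prime p && (p %| k)%N) ln (p%:R : R)
    <= n%:R * ln n%:R.
  apply: (@le_trans _ _ (\sum_(1 <= k < n.+1) ln (n%:R : R))).
    rewrite !big_nat; apply: ler_sum => k /andP[k_gt0 k_le].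
    rewrite (@ln_prodn R _ _ id) => [|p /andP[/prime_gt0]//].
    apply: lnn_le; first by apply: prodn_cond_gt0 => p /andP[/prime_gt0].
    by rewrite ltnS in k_le; apply: leq_trans k_le; apply: dvdn_leq (prod_primes_dvd _ _ _).
  by rewrite big_const_nat subn1 /= iter_addr addr0 mulr_natl.
rewrite (exchange_big_dep prime) /= in h1; last by move=> k p _ /andP[].
have h2 : \sum_(1 <= p < n.+1 | prime p) (n%:R / p%:R - 1) * ln (p%:R : R) <= n%:R * ln n%:R.
  apply: le_trans h1; apply: ler_sum => p p_pr; have p_gt0 := prime_gt0 p_pr.
  under eq_bigl => k do rewrite p_pr /= -[(p %| k)%N]andbT.
  rewrite (@sum_multiples R p n xpredT (fun=> ln p%:R)) //.
  rewrite big_const_nat subn1 /= iter_addr addr0 -[leRHS]mulr_natl ler_wpM2r ?lnn_ge0 //.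
  have p0 : 0 < p%:R :> R by rewrite ltr0n.
  rewrite lerBlDr ler_pdivrMr // natr1 -natrM ler_nat.
  by rewrite ltnW // ltn_ceil.
have h3 := theta_le R n.
have E : \sum_(1 <= p < n.+1 | prime p) (n%:R / p%:R - 1) * ln (p%:R : R)
   = n%:R * (\sum_(1 <= p < n.+1 | prime p) ln (p%:R : R) / p%:R)
     - \sum_(1 <= p < n.+1 | prime p) ln (p%:R : R).
  rewrite mulr_sumr -sumrB; apply: eq_bigr => p _; ring.
rewrite E in h2; rewrite -(ler_pM2l n0); lra.
Qed.

(** The subtracted remainder makes the induction close; the sum is thus at most [2], which accounts
    for replacing [1 / p] by [1 / (p - 1)] in the Mertens sum. *)
Lemma sum_lnk_divkk1_le (R : realType) (n : nat) :
  \sum_(2 <= k < n.+2) ln (k%:R : R) / (k%:R * (k%:R - 1)) <= 2 - (ln n.+1%:R + 2) / n.+1%:R.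
Proof.
elim: n => [|n IH]; first by rewrite big_geq // ln1; lra.
rewrite big_nat_recr //=; set S := (X in X + _ <= _) in IH *.
have a0 : 0 < n.+1%:R :> R by rewrite ltr0n.
have -> : n.+2%:R = n.+1%:R + 1 :> R by rewrite natr1.
have a1 : 1 <= n.+1%:R :> R by rewrite ler1n.
move: (n.+1%:R : R) IH a0 a1 => a IH a0 a1.
have h : ln (a + 1) <= ln a + a^-1.
  have -> : a + 1 = a * (1 + a^-1) by field; lra.
  have ia : 0 < a^-1 by rewrite invr_gt0.
  rewrite lnM ?posrE ?addr_gt0 //.
  by have := ln_le_subr1 (addr_gt0 ltr01 ia); lra.
apply: (le_trans (lerD IH (lexx _))).
suff : 0 <= (2 - (ln (a + 1) + 2) / (a + 1)) - (2 - (ln a + 2) / a + ln (a + 1) / ((a + 1) * (a + 1 - 1))).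
  by lra.
have -> : (2 - (ln (a + 1) + 2) / (a + 1)) - (2 - (ln a + 2) / a + ln (a + 1) / ((a + 1) * (a + 1 - 1)))
  = (2 - (a + 1) * (ln (a + 1) - ln a)) / (a * (a + 1)) by field; lra.
apply: divr_ge0; last by nra.
have : (a + 1) * (ln (a + 1) - ln a) <= (a + 1) * a^-1 by apply: ler_wpM2l; lra.
have -> : (a + 1) * a^-1 = 1 + a^-1 by field; lra.
have : a^-1 <= 1 by rewrite invf_le1.
lra.
Qed.

Lemma mertens_le (R : realType) (n : nat) : (0 < n)%N ->
  \sum_(1 <= p < n.+1 | prime p) ln (p%:R : R) / (p%:R - 1) <= ln n%:R + 5.
Proof.
move=> n_gt0; have h1 := sum_lnp_divp_le R n_gt0.
have h2 : \sum_(1 <= p < n.+1 | prime p) ln (p%:R : R) / (p%:R * (p%:R - 1)) <= 2.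
  case: n n_gt0 {h1} => // n _.
  rewrite big_ltn_cond //= big_mkcond /=.
  apply: (@le_trans _ _ (\sum_(2 <= k < n.+2) ln (k%:R : R) / (k%:R * (k%:R - 1)))).
    rewrite !big_nat; apply: ler_sum => k /andP[k_gt1 _]; case: ifP => // _.
    by rewrite divr_ge0 ?lnn_ge0 // mulr_ge0 // subr_ge0 ler1n ltnW.
  apply: (le_trans (sum_lnk_divkk1_le R n)).
  by rewrite gerBl divr_ge0 // addr_ge0 // lnn_ge0.
have -> : \sum_(1 <= p < n.+1 | prime p) ln (p%:R : R) / (p%:R - 1)
  = \sum_(1 <= p < n.+1 | prime p) ln (p%:R : R) / p%:R
  + \sum_(1 <= p < n.+1 | prime p) ln (p%:R : R) / (p%:R * (p%:R - 1)).
  rewrite -big_split; apply: eq_bigr => p p_pr /=.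
  have : 1 < p%:R :> R by rewrite ltr1n prime_gt1.
  by move=> p1; field; lra.
lra.
Qed.

Lemma mertens_trunc_le (R : realType) (n : nat) (T : R) : 0 <= T ->
  \sum_(1 <= p < n.+1 | prime p && (ln (p%:R : R) <= T)) ln (p%:R : R) / (p%:R - 1) <= T + 5.
Proof.
move=> T0; elim: n => [|n IH]; first by rewrite big_geq //; lra.
have [le|gt] := leP (ln (n.+1%:R : R)) T.
  apply: (@le_trans _ _ (ln n.+1%:R + 5)); last by lra.
  apply: le_trans (mertens_le R (ltn0Sn n)).
  rewrite big_mkcondr /=; apply: ler_sum => p p_pr; case: ifP => // _.
  by rewrite divr_ge0 ?lnn_ge0 // subr_ge0 ler1n prime_gt0.
by rewrite big_mkcond big_nat_recr //= (lt_geF gt) andbF addr0 -big_mkcond.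
Qed.

(* n^(-s) *)
Definition npow (R : realType) (s : R) (n : nat) : R := expR (- s * ln n%:R).

Lemma npow_weight (R : realType) (s : R) : 0 < s -> euler_weight (npow s).
Proof.
move=> s0; split.
- by rewrite /npow ln1 mulr0 expR0.
- move=> m n m0 n0; rewrite /npow natrM lnM ?posrE ?ltr0n // -expRD; congr expR; ring.
- by move=> n; apply: expR_ge0.
- move=> p p_pr; rewrite /npow expR_lt1 mulNr oppr_lt0 mulr_gt0 // ln_gt0 //.
  by rewrite ltr1n prime_gt1.
Qed.

Lemma npow1E (R : realType) (n : nat) : (0 < n)%N -> npow (1 : R) n = n%:R^-1.
Proof. by move=> n0; rewrite /npow mulN1r expRN lnK // posrE ltr0n. Qed.

Lemma npowD (R : realType) (s t : R) (n : nat) : npow (s + t) n = npow s n * npow t n.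
Proof. by rewrite /npow -expRD; congr expR; ring. Qed.

(** * Euler products of [n^-s] near [s = 1] *)

Lemma sum_npow_le (R : realType) (d : R) (Z : nat) : 0 < d ->
  \sum_(1 <= n < Z.+1) npow (1 + d) n <= 1 + d^-1.
Proof.
move=> d0; have i0 : 0 < d^-1 by rewrite invr_gt0.
case: Z => [|Z]; first by rewrite big_geq //; lra.
(* Strengthened for induction: the right side is [1] plus the integral of [x^(-1-d)] from [1] to
   [Z + 1]. *)
suff : \sum_(1 <= n < Z.+2) npow (1 + d) n <= 1 + d^-1 * (1 - npow d Z.+1).
  have : 0 <= d^-1 * npow d Z.+1 by rewrite mulr_ge0 ?expR_ge0 // ltW.
  by lra.
elim: Z => [|Z IH].
  by rewrite big_nat1 /npow ln1 !mulr0 expR0; lra.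
rewrite big_nat_recr //=; apply: (le_trans (lerD IH (lexx _))).
suff : npow (1 + d) Z.+2 <= d^-1 * (npow d Z.+1 - npow d Z.+2) by lra.
rewrite -(ler_pM2l d0) mulVKf ?gt_eqF // npowD npow1E //.
have a0 : 0 < Z.+1%:R :> R by rewrite ltr0n.
have c0 : 0 < Z.+2%:R :> R by rewrite ltr0n.
have E : Z.+1%:R = Z.+2%:R - 1 :> R by rewrite -[Z.+2%:R]natr1 addrK.
have -> : npow d Z.+1 = npow d Z.+2 * expR (d * (ln Z.+2%:R - ln Z.+1%:R)).
  by rewrite /npow -expRD; congr expR; ring.
have h : Z.+2%:R^-1 <= ln (Z.+2%:R : R) - ln Z.+1%:R.
  have := @ln_le_subr1 R (Z.+1%:R / Z.+2%:R); rewrite ln_div ?posrE // divr_gt0 // => /(_ isT).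
  have -> : Z.+1%:R / Z.+2%:R = 1 - Z.+2%:R^-1 :> R by rewrite E mulrBl mulfV ?gt_eqF // mul1r.
  by move: (Z.+2%:R^-1 : R) (ln _) (ln _) => u v w; lra.
have h2 := expR_ge1Dx (d * (ln (Z.+2%:R : R) - ln Z.+1%:R)).
have h3 := ler_wpM2l (ltW d0) h.
have x0 : 0 <= npow d Z.+2 by apply: expR_ge0.
have -> : d * (Z.+2%:R^-1 * npow d Z.+2) = npow d Z.+2 * (d * Z.+2%:R^-1) by ring.
rewrite -[X in _ - X]mulr1 -mulrBr; apply: ler_wpM2l => //.
by rewrite lerBrDl; apply: le_trans h2; rewrite lerD2l.
Qed.

Lemma euler_prod_ratio_le (R : realType) (f g : nat -> R) (c : nat -> R) (z : nat) :
  euler_weight f ->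
  (forall p, prime p -> (p <= z)%N -> 1 - f p <= (1 - g p) * expR (c p)) ->
  euler_prod f 0 z <= euler_prod g 0 z * expR (\sum_(1 <= p < z.+1 | prime p) c p).
Proof.
move=> [_ _ _ f1] h; rewrite expR_sum -big_split /= /euler_prod big_nat_cond [leRHS]big_nat_cond.
apply: ler_prod => p /andP[/andP[_ p_le] p_pr].
by rewrite h // andbT subr_ge0 ltW // f1.
Qed.

(** The ratio of the two Euler factors is exactly [1 + (1 - p^-d) / (p - 1)], and
    [1 + x <= expR x]. *)
Lemma one_sub_npow_right_le (R : realType) (d : R) (p : nat) : prime p ->
  1 - npow (1 + d) p <= (1 - npow 1 p) * expR ((1 - npow d p) / (p%:R - 1)).
Proof.
move=> p_pr; rewrite npowD npow1E ?prime_gt0 //.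
have p1 : 1 < p%:R :> R by rewrite ltr1n prime_gt1.
have -> : 1 - p%:R^-1 * npow d p = (1 - p%:R^-1) * (1 + (1 - npow d p) / (p%:R - 1)) by field; lra.
apply: ler_wpM2l; last exact: expR_ge1Dx.
by rewrite subr_ge0 invf_le1; lra.
Qed.

Lemma expR_half_le (R : realType) (x : R) : 0 <= x -> x <= 1 / 2 -> expR x - 1 <= x + 2 * x ^+ 2.
Proof.
move=> x0 x1; have := expR_ge1Dx (- x); rewrite expRN => h.
have e0 := expR_gt0 x; set y := expR x in h e0 *.
have h2 : (1 - x) * y <= 1.
  by have := ler_wpM2r (ltW e0) h; rewrite mulVf ?gt_eqF.
nra.
Qed.

(** With [t = (p^h - 1) / (p - 1)] the ratio of the factors is [1 - t], and [t <= 1 / 2] gives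
    [1 - t >= expR (- (t + 2 * t^2))]. Writing [x = h * ln p], the constant [10] is [2] from
    expanding [expR x] plus [8] from [t <= 2 * x / (p - 1)]. *)
Lemma one_sub_npow_left_ge (R : realType) (h : R) (p : nat) : prime p ->
  0 <= h -> h * ln p%:R <= 1 / 4 ->
  (1 - npow 1 p) * expR (- ((h * ln p%:R + 10 * (h * ln p%:R) ^+ 2) / (p%:R - 1)))
    <= 1 - npow (1 - h) p.
Proof.
move=> p_pr h0 hp; rewrite npowD npow1E ?prime_gt0 // /npow opprK.
have p1 : 2 <= p%:R :> R by rewrite ler_nat prime_gt1.
have x0 : 0 <= h * ln p%:R by rewrite mulr_ge0 ?lnn_ge0.
set x := h * ln p%:R in hp x0 *.
have ey : expR x - 1 <= x + 2 * x ^+ 2 by apply: expR_half_le; lra.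
have e1 := expR_ge1Dx x; set y := expR x in e1 ey *.
have ip0 : 0 < (p%:R - 1)^-1 :> R by rewrite invr_gt0; lra.
have ip1 : (p%:R - 1)^-1 <= 1 :> R by rewrite invf_le1; lra.
set w := (p%:R - 1)^-1 in ip0 ip1 *.
have -> : 1 - p%:R^-1 * y = (1 - p%:R^-1) * (1 - (y - 1) * w) by rewrite /w; field; lra.
apply: ler_wpM2l; first by rewrite subr_ge0 invf_le1; lra.
set t := (y - 1) * w.
have t0 : 0 <= t by rewrite /t; nra.
have tx : t <= (x + 2 * x ^+ 2) * w by rewrite /t; nra.
have tx2 : t <= 2 * x * w by nra.
have t1 : t <= 1 / 2 by nra.
have t2 : 2 * t ^+ 2 <= 8 * x ^+ 2 * w.
  have : t ^+ 2 <= (2 * x * w) ^+ 2 by rewrite ler_sqr ?nnegrE //; nra.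
  have : (2 * x * w) ^+ 2 <= 4 * x ^+ 2 * w by nra.
  lra.
have le1 : expR (- ((x + 10 * x ^+ 2) * w)) <= expR (- (t + 2 * t ^+ 2)) by rewrite ler_expR; nra.
apply: le_trans le1 _; rewrite expRN.
have := expR_ge1Dx (t + 2 * t ^+ 2); set v := expR _ => hv.
have v0 : 0 < v by nra.
rewrite -(ler_pM2r v0) mulVf ?gt_eqF //; nra.
Qed.

(** Move to exponent [1 + d] with [d = 1 / ln n]. There the full sum is at most
    [1 + ln n <= 3 * ln n], which bounds the product below; the move costs at most
    [expR (1 + 5 * d) <= expR 11], as [d <= 2]. *)
Lemma mertens_prod_ge (R : realType) (n : nat) : (1 < n)%N ->
  expR (- 11) / 3 / ln n%:R <= euler_prod (npow (1 : R)) 0 n.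
Proof.
move=> n_gt1; have L0 : 1 / 2 <= ln (n%:R : R).
  by apply: le_trans (ln2_ge_half R) _; apply: lnn_le.
set L := ln n%:R in L0 *; pose d : R := L^-1; have d0 : 0 < d by rewrite invr_gt0; lra.
have fW : euler_weight (npow (1 + d)) by apply: npow_weight; lra.
have h1 : euler_prod (npow (1 + d)) 0 n <= euler_prod (npow 1) 0 n * expR 11.
  apply: (le_trans (@euler_prod_ratio_le R _ (npow 1) (fun p => d * (ln p%:R / (p%:R - 1))) n fW _)).
    move=> p p_pr _; apply: (le_trans (one_sub_npow_right_le d p_pr)).
    have p1 : 1 < p%:R :> R by rewrite ltr1n prime_gt1.
    apply: ler_wpM2l; first by rewrite npow1E ?prime_gt0 // subr_ge0 invf_le1; lra.
    rewrite ler_expR mulrA ler_wpM2r ?invr_ge0 ?subr_ge0 ?(ltW p1) //.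
    by have := expR_ge1Dx (- d * ln p%:R); rewrite /npow; lra.
  apply: ler_wpM2l; first by apply: euler_prod_ge0; apply: npow_weight.
  rewrite -mulr_sumr ler_expR.
  have := ler_wpM2l (ltW d0) (mertens_le R (ltnW n_gt1)); rewrite -/L mulrDr.
  rewrite {2}/d mulVf; last by lra.
  have : d <= 2 by rewrite /d -[2]invrK lef_pV2 ?posrE; lra.
  lra.
have h2 : 1 <= (1 + L) * euler_prod (npow (1 + d)) 0 n.
  rewrite leNgt; apply/negP => lt1; set P := euler_prod _ _ _ in lt1.
  have P0 : 0 <= P by apply: euler_prod_ge0.
  have e0 : 0 < (1 - (1 + L) * P) / 2 by lra.
  have [Z hZ] := smooth_sum_euler_prod_ge n fW e0.
  have := hZ 0%N Z (leqnn Z); rewrite -/P.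
  have : smooth_sum (npow (1 + d)) 0 n Z * P <= (1 + L) * P.
    apply: ler_wpM2r => //; apply: (@le_trans _ _ (\sum_(1 <= k < Z.+1) npow (1 + d) k)).
      by rewrite /smooth_sum big_mkcond; apply: ler_sum => k _; case: ifP => // _; apply: expR_ge0.
    by have := sum_npow_le Z d0; rewrite {2}/d invrK.
  lra.
set P := euler_prod _ _ _ in h1 h2; set V := euler_prod _ _ _ in h1 *.
have e0 := expR_gt0 (11 : R); rewrite expRN; set e := expR 11 in h1 e0 *.
rewrite ler_pdivrMr; last by lra.
rewrite -(ler_pM2l e0) mulrA mulfV ?gt_eqF //.
have P0 : 0 <= P by apply: euler_prod_ge0.
have : (1 + L) * P <= 3 * L * (V * e) by apply: ler_pM; lra.
lra.
Qed.

(** * Shifting the exponent *)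

Lemma ln_addn2_le (R : realType) (b : nat) : (0 < b)%N ->
  ln (b.+2%:R : R) <= ln b%:R + 2.
Proof.
move=> b0; have b1 : 1 <= b%:R :> R by rewrite ler1n.
have -> : b.+2%:R = b%:R + 2 :> R by rewrite -addn2 natrD.
move: (b%:R : R) b1 => x x1.
have ix : 0 < x^-1 by rewrite invr_gt0; lra.
have ix1 : x^-1 <= 1 by rewrite invf_le1; lra.
have y0 : 0 < 1 + 2 * x^-1 by lra.
have -> : x + 2 = x * (1 + 2 * x^-1) by field; lra.
rewrite lnM ?posrE //; last by lra.
by have := ln_le_subr1 y0; lra.
Qed.

Lemma ln_minn_le (R : realType) (Q b : nat) : (0 < Q)%N -> (0 < b)%N ->
  ln ((minn b.+2 Q)%:R : R) <= ln b%:R + 2.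
Proof.
move=> Q0 b0; apply: le_trans (ln_addn2_le R b0).
by apply: lnn_le; rewrite ?leq_min ?geq_minl.
Qed.

Lemma chain_mass_right (R : realType) (d : R) (Q b : nat) : 0 < d ->
  chain_mass (npow (1 + d)) Q b <= chain_mass (npow 1) Q b *
   expR (\sum_(1 <= p < (minn b.+2 Q).+1 | prime p) (1 - npow d p) / (p%:R - 1)
         - d * ln b%:R).
Proof.
move=> d0; rewrite /chain_mass; set z := minn _ _.
have fW : euler_weight (npow (1 + d)) by apply: npow_weight; lra.
have h := @euler_prod_ratio_le R _ (npow 1) (fun p => (1 - npow d p) / (p%:R - 1)) z fW
  (fun p p_pr _ => one_sub_npow_right_le d p_pr).
rewrite npowD expRD {2}/npow -mulNr.
have e0 : 0 <= npow (1 : R) b by apply: expR_ge0.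
have e1 : 0 <= expR (- d * ln b%:R) by apply: expR_ge0.
have := ler_wpM2l (mulr_ge0 e0 e1) h; move/le_trans; apply.
by rewrite le_eqVlt; apply/orP; left; apply/eqP; ring.
Qed.

(** The Mertens sum contributes at most [d * (ln b + 7)] to the exponent, and the factor [b^-d]
    cancels the main term. *)
Lemma chain_mass_right_le (R : realType) (d : R) (Q b : nat) : 0 < d ->
  (0 < Q)%N -> (0 < b)%N ->
  chain_mass (npow (1 + d)) Q b <= chain_mass (npow 1) Q b * expR (7 * d).
Proof.
move=> d0 Q0 b0; apply: (le_trans (chain_mass_right Q b d0)).
apply: ler_wpM2l; first by apply: chain_mass_ge0; apply: npow_weight.
rewrite ler_expR; have z0 : (0 < minn b.+2 Q)%N by rewrite leq_min.
set z := minn _ _ in z0 *.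
have h : \sum_(1 <= p < z.+1 | prime p) (1 - npow d p) / (p%:R - 1)
   <= d * \sum_(1 <= p < z.+1 | prime p) ln (p%:R : R) / (p%:R - 1).
  rewrite mulr_sumr; apply: ler_sum => p p_pr; rewrite mulrA ler_wpM2r //.
    by rewrite invr_ge0 subr_ge0 ler1n prime_gt0.
  by have := expR_ge1Dx (- d * ln p%:R); rewrite /npow; lra.
have h2 : ln (z%:R : R) <= ln b%:R + 2 by apply: ln_minn_le.
have := mertens_le R z0; move: h; set S := \sum_(_ <= _ < _ | _) (ln _ / _) => h h3.
have := ler_wpM2l (ltW d0) (_ : S <= ln b%:R + 7).
have -> : S <= ln b%:R + 7 by lra.
by move=> /(_ isT); lra.
Qed.

(* Beyond exp(2/d) the bound 1 - p^-d <= 1 beats 1 - p^-d <= d ln p by a factor 2. *)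
Lemma chain_mass_right_half (R : realType) (d : R) (Q b : nat) : 0 < d -> d <= 1 ->
  (0 < Q)%N -> (0 < b)%N -> 16 <= d * ln b%:R ->
  chain_mass (npow (1 + d)) Q b <= chain_mass (npow 1) Q b / 2.
Proof.
move=> d0 d1 Q0 b0 hb; apply: (le_trans (chain_mass_right Q b d0)).
apply: ler_wpM2l; first by apply: chain_mass_ge0; apply: npow_weight.
(* The threshold [16] makes the exponent at most [1 + 6 * d - d * ln b / 2 <= -1]. *)
apply: (@le_trans _ _ (expR (- 1))); last first.
  rewrite expRN lef_pV2 ?posrE ?expR_gt0 //.
  by have := expR_ge1Dx (1 : R); lra.
rewrite ler_expR; have z0 : (0 < minn b.+2 Q)%N by rewrite leq_min.
set z := minn _ _ in z0 *.
have id : 0 < d^-1 by rewrite invr_gt0.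
have h : \sum_(1 <= p < z.+1 | prime p) (1 - npow d p) / (p%:R - 1)
   <= d / 2 * \sum_(1 <= p < z.+1 | prime p) ln (p%:R : R) / (p%:R - 1)
    + d / 2 * \sum_(1 <= p < z.+1 | prime p && (ln (p%:R : R) <= 2 * d^-1)) ln (p%:R : R) / (p%:R - 1).
  rewrite big_mkcondr !mulr_sumr -big_split /=; apply: ler_sum => p p_pr.
  have w0 : 0 <= (p%:R - 1 : R)^-1 by rewrite invr_ge0 subr_ge0 ler1n prime_gt0.
  case: ifP => [_|/negbT].
    have -> : d / 2 * (ln p%:R / (p%:R - 1)) + d / 2 * (ln p%:R / (p%:R - 1))
       = (d * ln p%:R) / (p%:R - 1) :> R by field; rewrite subr_eq0 (eqr_nat R p 1); move: (prime_gt1 p_pr); lia.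
    rewrite ler_wpM2r //.
    by have := expR_ge1Dx (- d * ln p%:R); rewrite /npow; lra.
  rewrite -ltNge mulr0 addr0 mulrA => gt_l; rewrite ler_wpM2r //.
  have := expR_ge0 (- d * ln (p%:R : R)); rewrite -/(npow d p) => e0.
  have := ler_wpM2l (ltW d0) (ltW gt_l).
  have -> : d * (2 * d^-1) = 2 by field; lra.
  lra.
have h2 : ln (z%:R : R) <= ln b%:R + 2 by apply: ln_minn_le.
have h3 := mertens_le R z0.
have T0 : 0 <= 2 * d^-1 by lra.
have h4 := mertens_trunc_le z T0.
move: h h3 h4; set S := \sum_(_ <= _ < _ | _) (ln _ / _); set S' := \sum_(_ <= _ < _ | _ && _) (ln _ / _) => h h3 h4.
have d20 : 0 <= d / 2 by lra.
have := ler_wpM2l d20 (_ : S <= ln b%:R + 7).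
have -> : S <= ln b%:R + 7 by lra.
move=> /(_ isT); have := ler_wpM2l d20 h4.
have -> : d / 2 * (2 * d^-1 + 5) = 1 + 5 / 2 * d by field; lra.
lra.
Qed.

Lemma chain_tail (R : realType) : exists2 C : R, 0 < C & forall (Q Z : nat) (Y : R),
  (0 < Q)%N -> 0 < Y ->
  \sum_(1 <= b < Z.+1 | smooth_chained Q b && (Y <= ln (b%:R : R))) chain_mass (npow 1) Q b
    <= C / Y.
Proof.
have E7 : 1 <= expR 7 :> R by have := expR_ge1Dx (7 : R); lra.
exists (256 * expR 7) => [|Q Z Y Q0 Y0]; first by lra.
have w1 : euler_weight (npow (1 : R)) by apply: npow_weight.
have [Y16|Y16] := leP 16 Y; last first.
  apply: (@le_trans _ _ 1).
    apply: le_trans (chain_mass_le1 Q Z w1); rewrite big_mkcondr /=.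
    by apply: ler_sum => b _; case: ifP => // _; apply: chain_mass_ge0.
  by rewrite ler_pdivlMr //; lra.
(* The least shift for which every [b] with [ln b >= Y] falls under [chain_mass_right_half]. *)
pose d := 16 / Y; have d0 : 0 < d by apply: divr_gt0.
have d1 : d <= 1 by rewrite ler_pdivrMr // mul1r.
have w2 : euler_weight (npow (1 + d)) by apply: npow_weight; lra.
have [Z0 hZ] := chain_mass_ge Q w2 d0.
have := hZ (maxn Z Z0) (leq_maxr _ _).
(* If the tail exceeded [16 * d * expR 7], so would [A], and the mass at [1 + d] would be at most [A
   / 2 + (1 - A) * expR (7 * d) <= expR (7 * d) - A / 2 < 1 + (7 - 8) * d * expR 7 <= 1 - d],
   against the lower bound. *)
apply: contraTT; rewrite -!ltNge; set L := \sum_(_ <= _ < _ | _) _ => hL.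
have := chain_mass_le1 Q (maxn Z Z0) w1; set Z1 := maxn Z Z0.
rewrite !(bigID (fun b => Y <= ln (b%:R : R)) (smooth_chained Q)) /=.
set A := \sum_(_ <= _ < _ | _ && (_ <= _)) chain_mass (npow 1) _ _.
set B := \sum_(_ <= _ < _ | _ && ~~ _) chain_mass (npow 1) _ _ => AB.
have LA : L <= A.
  rewrite /A (@big_cat_nat _ _ _ Z.+1) //=; last by rewrite ltnS leq_maxl.
  by rewrite lerDl; apply: sumr_ge0 => b _; apply: chain_mass_ge0.
have h1 : \sum_(1 <= b < Z1.+1 | smooth_chained Q b && (Y <= ln (b%:R : R))) chain_mass (npow (1 + d)) Q b <= A / 2.
  rewrite /A mulr_suml; apply: ler_sum => b /andP[/andP[bB _] hb].
  apply: chain_mass_right_half => //; first exact: chained_gt0 bB.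
  rewrite /d mulrAC ler_pdivlMr //; lra.
have h2 : \sum_(1 <= b < Z1.+1 | smooth_chained Q b && ~~ (Y <= ln (b%:R : R))) chain_mass (npow (1 + d)) Q b <= B * expR (7 * d).
  rewrite /B mulr_suml; apply: ler_sum => b /andP[/andP[bB _] _].
  by apply: chain_mass_right_le => //; exact: chained_gt0 bB.
have B0 : 0 <= B by apply: sumr_ge0 => b _; apply: chain_mass_ge0.
have e7 : expR (7 * d) <= expR 7 by rewrite ler_expR; lra.
have e8 : expR (7 * d) - 1 <= 7 * d * expR 7.
  have := expR_ge1Dx (- (7 * d)); rewrite expRN; have := expR_gt0 (7 * d).
  set e := expR (7 * d) in e7 * => e0 h.
  have := ler_wpM2r (ltW e0) h; rewrite mulVf ?gt_eqF // => h'.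
  have : (7 * d) * e <= (7 * d) * expR 7 by apply: ler_wpM2l; lra.
  lra.
have E1 : 1 <= expR (7 * d) by have := expR_ge1Dx (7 * d); lra.
have EL : 256 * expR 7 / Y = 16 * d * expR 7 by rewrite /d; field; lra.
rewrite EL in hL.
apply: le_lt_trans (lerD h1 h2) _.
have : d <= d * expR 7 by rewrite ler_peMr // ltW.
have : B * expR (7 * d) <= (1 - A) * expR (7 * d) by apply: ler_wpM2r; lra.
have A0 : 0 <= A by apply: sumr_ge0 => b _; apply: chain_mass_ge0.
have : A <= A * expR (7 * d) by rewrite ler_peMr.
lra.
Qed.

(** For [b <= Q] the terms [h * ln b] and [h * l] nearly cancel, leaving a small loss; for [b > Q]
    the value [l] stays at [ln Q], so the gain [b^h] survives. *)
Lemma chain_mass_left_ge (R : realType) (h : R) (Q b : nat) : (0 < Q)%N ->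
  0 < h -> h < 1 -> h * ln Q%:R <= 1 / 4 ->
  let l := ln (minn b.+2 Q)%:R in
  chain_mass (npow 1) Q b * expR (h * ln b%:R - (h + 10 * h ^+ 2 * l) * (l + 5))
   <= chain_mass (npow (1 - h)) Q b.
Proof.
move=> Q0 h0 h1 hQ; have z0 : (0 < minn b.+2 Q)%N by rewrite leq_min.
rewrite /chain_mass /=; have zQ : (minn b.+2 Q <= Q)%N by apply: geq_minr.
set z := minn _ _ in z0 zQ *; set l := ln z%:R.
have w1 : euler_weight (npow (1 : R)) by apply: npow_weight.
have w2 : euler_weight (npow (1 - h)) by apply: npow_weight; lra.
pose c p := (h * ln (p%:R : R) + 10 * (h * ln p%:R) ^+ 2) / (p%:R - 1).
have hle : euler_prod (npow 1) 0 z <= euler_prod (npow (1 - h)) 0 z * expR (\sum_(1 <= p < z.+1 | prime p) c p).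
  apply: euler_prod_ratio_le => // p p_pr p_le.
  have hp : h * ln p%:R <= 1 / 4.
    apply: le_trans hQ; apply: ler_wpM2l; first exact: ltW.
    by apply: lnn_le (prime_gt0 p_pr) (leq_trans p_le zQ).
  have := one_sub_npow_left_ge p_pr (ltW h0) hp; rewrite -/(c p) expRN.
  by rewrite ler_pdivrMr ?expR_gt0.
have hc : \sum_(1 <= p < z.+1 | prime p) c p <= (h + 10 * h ^+ 2 * l) * (l + 5).
  have l0 : 0 <= l by apply: lnn_ge0.
  have k0 : 0 <= h + 10 * h ^+ 2 * l by nra.
  apply: le_trans (ler_wpM2l k0 (mertens_le R z0)); rewrite mulr_sumr.
  rewrite big_nat_cond [leRHS]big_nat_cond; apply: ler_sum => p /andP[/andP[p_gt0 p_le] p_pr].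
  rewrite /c [leRHS]mulrA ler_wpM2r //; first by rewrite invr_ge0 subr_ge0 ler1n.
  have lp : ln (p%:R : R) <= l by apply: lnn_le.
  have lp0 := lnn_ge0 R p; set y := ln p%:R in lp lp0 *.
  have : h ^+ 2 * (y * y) <= h ^+ 2 * (l * y).
    by apply: ler_wpM2l; [apply: sqr_ge0|apply: ler_wpM2r].
  by lra.
rewrite npowD /npow -/(npow 1 b) opprK expRD.
have : euler_prod (npow 1) 0 z * expR (- ((h + 10 * h ^+ 2 * l) * (l + 5))) <= euler_prod (npow (1 - h)) 0 z.
  rewrite expRN ler_pdivrMr ?expR_gt0 //; apply: (le_trans hle).
  by apply: ler_wpM2l; [apply: euler_prod_ge0|rewrite ler_expR].
have e0 : 0 <= npow (1 : R) b * expR (h * ln b%:R) by rewrite mulr_ge0 ?expR_ge0.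
move/(ler_wpM2l e0); apply: le_trans.
by rewrite le_eqVlt; apply/orP; left; apply/eqP; ring.
Qed.

Lemma sum_abel (R : realType) (a w : nat -> R) (P : pred nat) (n : nat) : w 1%N = 0 ->
  \sum_(1 <= b < n.+1 | P b) a b * w b
  = \sum_(1 <= j < n) (w j.+1 - w j) * \sum_(1 <= b < n.+1 | P b && (j < b)%N) a b.
Proof.
move=> w1; under [RHS]eq_bigr => j _ do rewrite mulr_sumr.
rewrite (exchange_big_dep P) /=; last by move=> j b _ /andP[].
rewrite big_nat_cond [RHS]big_nat_cond; apply: eq_bigr => b /andP[/andP[b_gt0 b_le] Pb].
rewrite -mulr_suml mulrC; congr (_ * _); rewrite Pb /=.
have := @big_nat_widen R 0 +%R 1 b n xpredT (fun j => w j.+1 - w j) b_le.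
by rewrite /= telescope_sumr // w1 subr0.
Qed.

(** Partial summation of the tail bound: with [x = ln (j + 1)] and [y = ln j], each step costs at
    most [(x^2 - y^2) * C / x <= 2 * C * (x - y)], which telescopes. *)
Lemma chain_ln_sqr (R : realType) : exists2 C : R, 0 < C & forall Q : nat, (0 < Q)%N ->
  \sum_(1 <= b < Q.+1 | smooth_chained Q b) chain_mass (npow 1) Q b * ln (b%:R : R) ^+ 2
   <= C * ln Q%:R.
Proof.
have [C C0 hC] := chain_tail R; exists (2 * C) => [|Q Q0]; first by lra.
rewrite (@sum_abel R _ (fun b => ln (b%:R : R) ^+ 2)); last by rewrite ln1 expr0n.
have -> : ln (Q%:R : R) = \sum_(1 <= j < Q) (ln j.+1%:R - ln j%:R).
  by rewrite telescope_sumr // ln1 subr0.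
rewrite mulr_sumr !big_nat; apply: ler_sum => j /andP[j_gt0 j_le].
have l0 : 0 < ln (j.+1%:R : R) by rewrite ln_gt0 // ltr1n.
have lj0 := lnn_ge0 R j; have lj : ln (j%:R : R) <= ln j.+1%:R by apply: lnn_le.
have := hC Q Q _ Q0 l0; set S := \sum_(_ <= _ < _ | _) _ => hS.
have hT : \sum_(1 <= b < Q.+1 | smooth_chained Q b && (j < b)%N) chain_mass (npow (1 : R)) Q b <= C / ln j.+1%:R.
  apply: le_trans hS; rewrite /S [leLHS]big_mkcondr [leRHS]big_mkcondr /=; apply: ler_sum => b bB.
  case: ifP => [lt_jb|_]; first by rewrite lnn_le.
  by case: ifP => // _; apply: chain_mass_ge0; apply: npow_weight.
move: hT; set T := \sum_(_ <= _ < _ | _) _; rewrite ler_pdivlMr //.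
have T0 : 0 <= T by apply: sumr_ge0 => b _; apply: chain_mass_ge0; apply: npow_weight.
move: (ln (j.+1%:R : R)) (ln (j%:R : R)) l0 lj0 lj => x y x0 y0 xy hT.
have -> : (x ^+ 2 - y ^+ 2) * T = (x - y) * ((x + y) * T) by ring.
have -> : 2 * C * (x - y) = (x - y) * (2 * C) by ring.
apply: ler_wpM2l; first by lra.
nra.
Qed.

(** At exponent [1 - h] the total mass is at most [1], and the [b <= Q] already carry [1 - O(h)] of
    it. Each [b > Q] has mass at least a constant times [b^h / (b * ln Q)], so the factors
    [1 / ln Q] cancel. *)
Lemma chain_rankin (R : realType) : exists2 C : R, 0 < C & forall Q Z : nat, (1 < Q)%N ->
  \sum_(1 <= b < Z.+1 | smooth_chained Q b && (Q < b)%N)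
     expR ((4 * ln Q%:R)^-1 * ln b%:R) / b%:R <= C.
Proof.
have [C C0 hC] := chain_tail R; have [C' C'0 hC'] := chain_ln_sqr R.
pose c0 : R := expR (- 11) / 3; have c00 : 0 < c0 by rewrite divr_gt0 ?expR_gt0.
(* [N / L] is the bound [498 * h + C / L + 5 * C' * h] on the mass beyond [Q], with
   [h = 1 / (4 * L)] and [L = ln Q]. *)
have [N N0 EN] : exists2 N : R, 0 < N & N = 498 / 4 + C + 5 / 4 * C'.
  by exists (498 / 4 + C + 5 / 4 * C'); lra.
exists (N * expR 10 / c0) => [|Q Z Q1]; first by rewrite divr_gt0 // mulr_gt0 ?expR_gt0.
have Q0 := ltnW Q1.
have L0 : 1 / 2 <= ln (Q%:R : R) by apply: le_trans (ln2_ge_half R) _; apply: lnn_le.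
set L := ln Q%:R in L0 *; set h := (4 * L)^-1.
have h0 : 0 < h by rewrite invr_gt0; lra.
have hL : h * L = 1 / 4 by rewrite /h; field; lra.
have h12 : h <= 1 / 2 by nra.
have w1 : euler_weight (npow (1 : R)) by apply: npow_weight.
have w2 : euler_weight (npow (1 - h)) by apply: npow_weight; lra.
have [Z0 hZ] := chain_mass_ge Q w1 h0.
pose Z1 := maxn Q (maxn Z Z0).
have lower := hZ Z1 _; have upper := chain_mass_le1 Q Z1 w2.
have {hZ}lower : 1 - h <= \sum_(1 <= b < Z1.+1 | smooth_chained Q b) chain_mass (npow 1) Q b.
  by apply: lower; rewrite !leq_max leqnn !orbT.
rewrite (bigID (fun b => Q < b)%N) /= in lower.
rewrite (bigID (fun b => Q < b)%N) /= in upper.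
have small (F : nat -> R) : \sum_(1 <= b < Z1.+1 | smooth_chained Q b && ~~ (Q < b)%N) F b
   = \sum_(1 <= b < Q.+1 | smooth_chained Q b) F b.
  rewrite [RHS](@big_nat_widen _ _ _ 1 Q.+1 Z1.+1); last by rewrite ltnS leq_maxl.
  by apply: eq_bigl => b; rewrite -leqNgt ltnS.
rewrite !small in lower upper.
have mid : \sum_(1 <= b < Z1.+1 | smooth_chained Q b && (Q < b)%N) chain_mass (npow 1) Q b <= C / L.
  apply: le_trans (hC Q Z1 L Q0 _); last by lra.
  rewrite [leLHS]big_mkcondr [leRHS]big_mkcondr /=; apply: ler_sum => b bB.
  case: ifP => [lt_Qb|_]; first by rewrite lnn_le // ltnW.
  by case: ifP => // _; apply: chain_mass_ge0.
(* Here [497 = 7 + 490]: the linear loss [7 * h] and [980 * h^2 <= 490 * h], using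
   [(x + 7)^2 <= 2 * x^2 + 98] and [h <= 1 / 2]. *)
have small_le : (1 - 497 * h) * \sum_(1 <= b < Q.+1 | smooth_chained Q b) chain_mass (npow 1) Q b
     - 20 * h ^+ 2 * \sum_(1 <= b < Q.+1 | smooth_chained Q b) chain_mass (npow 1) Q b * ln (b%:R : R) ^+ 2
   <= \sum_(1 <= b < Q.+1 | smooth_chained Q b) chain_mass (npow (1 - h)) Q b.
  rewrite !mulr_sumr -sumrB; apply: ler_sum => b /andP[bB _]; have b0 := chained_gt0 bB.
  apply: le_trans (chain_mass_left_ge b Q0 h0 _ _); [|lra|by rewrite hL].
  have m0 := chain_mass_ge0 Q b w1; set m := chain_mass _ _ _ in m0 *.
  have l2 := ln_minn_le R Q0 b0; have l0 := lnn_ge0 R (minn b.+2 Q).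
  have x0 := lnn_ge0 R b.
  move: (ln ((minn b.+2 Q)%:R : R)) (ln (b%:R : R)) l2 l0 x0 => l x l2 l0 x0.
  have -> : (1 - 497 * h) * m - 20 * h ^+ 2 * (m * x ^+ 2)
     = m * (1 - 497 * h - 20 * h ^+ 2 * x ^+ 2) by ring.
  apply: ler_wpM2l => //; apply: le_trans (expR_ge1Dx _).
  have k1 : (h + 10 * h ^+ 2 * l) * (l + 5) <= (h + 10 * h ^+ 2 * (x + 7)) * (x + 7).
    apply: ler_pM; [nra|lra| |lra].
    by rewrite lerD2l ler_wpM2l //; [rewrite mulr_ge0 // sqr_ge0|lra].
  have k2 : 10 * h ^+ 2 * (x + 7) * (x + 7) <= 10 * h ^+ 2 * (2 * x ^+ 2 + 98).
    rewrite -mulrA; apply: ler_wpM2l; first by rewrite mulr_ge0 // sqr_ge0.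
    by have := sqr_ge0 (x - 7); rewrite sqrrB; lra.
  have k3 : h ^+ 2 <= h / 2 by rewrite expr2 ler_wpM2l //; lra.
  lra.
have sq := hC' Q Q0; rewrite -/L in sq.
have S0 : 0 <= \sum_(1 <= b < Q.+1 | smooth_chained Q b) chain_mass (npow (1 : R)) Q b.
  by apply: sumr_ge0 => b _; apply: chain_mass_ge0.
have S1 := chain_mass_le1 Q Q w1.
have big_le : c0 / L * expR (- 10) * (\sum_(1 <= b < Z.+1 | smooth_chained Q b && (Q < b)%N) expR (h * ln b%:R) / b%:R)
   <= \sum_(1 <= b < Z1.+1 | smooth_chained Q b && (Q < b)%N) chain_mass (npow (1 - h)) Q b.
  apply: (@le_trans _ _ (\sum_(1 <= b < Z.+1 | smooth_chained Q b && (Q < b)%N) chain_mass (npow (1 - h)) Q b)); last first.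
    rewrite [leRHS](@big_cat_nat _ _ _ Z.+1) //=; last by rewrite ltnS !leq_max leqnn orbT.
    by rewrite lerDl; apply: sumr_ge0 => b _; apply: chain_mass_ge0.
  rewrite mulr_sumr; apply: ler_sum => b /andP[/andP[bB _] Qb]; have b0 := chained_gt0 bB.
  apply: le_trans (chain_mass_left_ge b Q0 h0 _ _); [|lra|by rewrite hL].
  (* Beyond [Q] the Euler product runs over all primes up to [Q], whatever [b] is, and the Mertens
     lower bound [c0 / L] applies. *)
  have -> : minn b.+2 Q = Q by apply/minn_idPr; rewrite (leq_trans (ltnW Qb)) // !leqW.
  rewrite -/L /chain_mass (_ : minn b.+2 Q = Q); last by apply/minn_idPr; rewrite (leq_trans (ltnW Qb)) // !leqW.
  rewrite npow1E // expRD.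
  have V := mertens_prod_ge R Q1; rewrite -/c0 -/L in V.
  have eb := expR_ge0 (h * ln (b%:R : R)); have ib : 0 <= b%:R^-1 :> R by rewrite invr_ge0.
  have ee : expR (- 10) <= expR (- ((h + 10 * h ^+ 2 * L) * (L + 5))) :> R.
    rewrite ler_expR lerN2.
    have -> : (h + 10 * h ^+ 2 * L) * (L + 5) = (1 + 10 * (h * L)) * (h * L + 5 * h) by ring.
    by rewrite hL; lra.
  have : c0 / L * expR (- 10) <= euler_prod (npow 1) 0 Q * expR (- ((h + 10 * h ^+ 2 * L) * (L + 5))).
    apply: ler_pM V ee; last exact: expR_ge0.
    by rewrite divr_ge0 ?(ltW c00) //; lra.
  move/(ler_wpM2r (mulr_ge0 eb ib)) => /le_trans; apply.
  by rewrite le_eqVlt; apply/orP; left; apply/eqP; ring.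
move: big_le small_le upper lower mid sq S0 S1.
set X := \sum_(_ <= _ < _ | _) (expR _ / _).
set A := \sum_(_ <= _ < _ | _ && _) chain_mass (npow (1 - h)) _ _.
set B := \sum_(_ <= _ < _ | _ && _) chain_mass (npow 1) _ _.
set A' := \sum_(_ <= _ < _ | _) chain_mass (npow (1 - h)) _ _.
set B' := \sum_(_ <= _ < _ | _) chain_mass (npow 1) _ _.
set W := \sum_(_ <= _ < _ | _) (_ * _).
move=> big_le small_le upper lower mid sq S0 S1.
have k1 : 20 * h ^+ 2 * W <= 20 * h ^+ 2 * (C' * L).
  by apply: ler_wpM2l => //; rewrite mulr_ge0 // sqr_ge0.
have k2 : 20 * h ^+ 2 * (C' * L) = 5 * C' * h.
  have -> : 20 * h ^+ 2 * (C' * L) = 20 * C' * h * (h * L) by ring.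
  by rewrite hL; field.
have k3 : 497 * h * B' <= 497 * h by apply: ler_piMr S1; lra.
have k4 : A <= 498 * h + C / L + 5 * C' * h by lra.
have k5 : h = 1 / 4 / L by rewrite /h; field; lra.
have k6 : c0 / L * expR (- 10) * X <= N / L.
  apply: (le_trans big_le); apply: (le_trans k4); rewrite k5 EN le_eqVlt.
  by apply/orP; left; apply/eqP; field; lra.
rewrite expRN in k6; have E0 := expR_gt0 (10 : R).
have Lp : 0 < L by lra.
have := ler_wpM2r (ltW Lp) k6; rewrite divfK ?gt_eqF //.
have -> : c0 / L * (expR 10)^-1 * X * L = X * c0 / expR 10 by field; rewrite ?gt_eqF.
by rewrite ler_pdivrMr // ler_pdivlMr.
Qed.

Lemma expR_ge_half_sqr (R : realType) (x : R) : 0 <= x -> x ^+ 2 <= 2 * expR x.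
Proof. by move=> x0; have := expR_ge1Dxn 1 x0; rewrite -[2`!]/2%N; lra. Qed.

(** For [b > Q], the Rankin weight is at least [(ln b / (4 * ln Q))^2 / 2], hence the constant [32].
    For [b <= Q], the mass is at least [c0 / (b * ln Q)] and [chain_tail] applies; that range is
    empty unless [Y <= ln Q], so one factor [ln Q / Y] may be squared. *)
Lemma smooth_chain_tail (R : realType) : exists2 C : R, 0 < C &
  forall (Q Z : nat) (Y : R), (1 < Q)%N -> 0 < Y ->
  \sum_(1 <= b < Z.+1 | smooth_chained Q b && (Y <= ln (b%:R : R))) b%:R^-1
    <= C * (ln Q%:R / Y) ^+ 2.
Proof.
have [C C0 hC] := chain_tail R; have [D D0 hD] := chain_rankin R.
pose c0 : R := expR (- 11) / 3; have c00 : 0 < c0 by rewrite divr_gt0 ?expR_gt0.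
exists (32 * D + C / c0) => [|Q Z Y Q1 Y0].
  by have := divr_gt0 C0 c00; lra.
have Q0 := ltnW Q1.
have L0 : 1 / 2 <= ln (Q%:R : R) by apply: le_trans (ln2_ge_half R) _; apply: lnn_le.
have hCQ := hC Q Z Y Q0 Y0; have hDQ := hD Q Z Q1.
have V (k : nat) : (1 < k)%N -> c0 / ln k%:R <= euler_prod (npow (1 : R)) 0 k := @mertens_prod_ge R k.
set L := ln Q%:R in L0 hDQ *; have Lp : 0 < L by lra.
rewrite mulrDl (bigID (fun b => Q < b)%N) /=; apply: lerD.
  apply: (@le_trans _ _ (32 * (L / Y) ^+ 2 * D)); last by rewrite le_eqVlt mulrAC eqxx.
  have u0 : 0 <= 32 * (L / Y) ^+ 2 by rewrite mulr_ge0 // sqr_ge0.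
  apply: le_trans (ler_wpM2l u0 hDQ); rewrite mulr_sumr.
  rewrite (eq_bigl (fun b => (smooth_chained Q b && (Q < b)%N) && (Y <= ln (b%:R : R)))); last first.
    by move=> b; rewrite andbAC.
  rewrite big_mkcondr /=; apply: ler_sum => b /andP[/andP[bB _] Qb].
  have b0 := chained_gt0 bB; have ib : 0 <= b%:R^-1 :> R by rewrite invr_ge0.
  have e0 := expR_ge0 ((4 * L)^-1 * ln (b%:R : R)).
  case: ifP => [Yb|_]; last exact: mulr_ge0 u0 (mulr_ge0 e0 ib).
  rewrite [leRHS]mulrA -[leLHS]mul1r; apply: ler_wpM2r => //.
  have lb0 := lnn_ge0 R b; have x0 : 0 <= (4 * L)^-1 * ln (b%:R : R) by rewrite mulr_ge0 // invr_ge0; lra.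
  move: (expR_ge_half_sqr x0) Yb {e0}.
  move: (expR ((4 * L)^-1 * ln (b%:R : R))) => e; move: (ln (b%:R : R)) {lb0 x0} => x he Yx.
  have := ler_wpM2l (sqr_ge0 (L / Y)) he.
  have -> : (L / Y) ^+ 2 * ((4 * L)^-1 * x) ^+ 2 = (x / Y) ^+ 2 / 16 by field; lra.
  have h1 : 1 <= x / Y by rewrite ler_pdivlMr // mul1r.
  have : 1 <= (x / Y) ^+ 2 by rewrite exprn_ege1.
  lra.
have [YL|YL] := leP Y L; last first.
  rewrite big1 => [|b /andP[/andP[_ Yb]]].
    by rewrite mulr_ge0 ?sqr_ge0 // divr_ge0 ?ltW.
  rewrite -leqNgt => bQ.
  (* [big1] forgets the summation range, so [b = 0] has to be covered; its inverse is [0]. *)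
  have [->|b0] := posnP b; first by rewrite invr0.
  by have := lnn_le R b0 bQ; rewrite -/L; lra.
apply: (@le_trans _ _ (L / c0 * (C / Y))); last first.
  have -> : L / c0 * (C / Y) = C / c0 * (L / Y) by field; lra.
  apply: ler_wpM2l; first by rewrite divr_ge0 ?ltW.
  by rewrite expr2 ler_peMl ?divr_ge0 ?(ltW Lp) ?(ltW Y0) // ler_pdivlMr // mul1r.
have u0 : 0 <= L / c0 by rewrite divr_ge0 ?ltW.
apply: le_trans (ler_wpM2l u0 hCQ); rewrite mulr_sumr big_mkcondr /=.
apply: ler_sum => b /andP[/andP[bB _] Yb]; have b0 := chained_gt0 bB.
have m0 := chain_mass_ge0 Q b (npow_weight (ltr01 : 0 < 1 :> R)).
case: ifP => _; last by rewrite mulr_ge0.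
rewrite /chain_mass npow1E // mulrCA ler_peMr ?invr_ge0 //.
have z1 : (1 < minn b.+2 Q)%N by rewrite leq_min Q1.
have := V _ z1; set z := minn _ _ in z1 * => Vz.
have lz : ln (z%:R : R) <= L by apply: lnn_le; [exact: ltnW|exact: geq_minr].
have lz0 : 0 < ln (z%:R : R) by rewrite ln_gt0 // ltr1n.
have : L / c0 * (c0 / ln z%:R) <= L / c0 * euler_prod (npow 1) 0 z by apply: ler_wpM2l.
apply: le_trans; have -> : L / c0 * (c0 / ln z%:R) = L / ln z%:R by field; rewrite ?gt_eqF.
by rewrite ler_pdivlMr // mul1r.
Qed.

(** * Counting *)

(** Partial summation over the largest prime: [1 / ln P] is [1 / ln N] plus the telescoping
    differences [D j] for [P <= j < N], so the inner sums become tails over [j]-smooth chained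
    numbers. Each of the two parts costs [C * ln N / Y^2]. *)
Lemma sum_inv_ln_max_pdiv (R : realType) : exists2 C : R, 0 < C &
  forall (N : nat) (Y : R), (1 < N)%N -> 0 < Y ->
  \sum_(2 <= m < N.+1 | chained m && (Y <= ln (m%:R : R)))
     m%:R^-1 * (ln (max_pdiv m)%:R)^-1 <= C * ln N%:R / Y ^+ 2.
Proof.
have [C C0 hC] := smooth_chain_tail R; exists (2 * C) => [|N Y N1 Y0]; first by lra.
have lnp (j : nat) : (1 < j)%N -> 0 < ln (j%:R : R) by move=> j1; rewrite ln_gt0 // ltr1n.
pose D j : R := (ln j%:R)^-1 - (ln j.+1%:R)^-1.
have D0 j : (1 < j)%N -> 0 <= D j.
  by move=> j1; rewrite subr_ge0 lef_pV2 ?posrE ?lnp ?lnn_le // ltnW.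
have smooth_le j : (1 < j)%N ->
    \sum_(2 <= m < N.+1 | chained m && (Y <= ln (m%:R : R)) && (max_pdiv m <= j)%N) m%:R^-1
    <= C * (ln j%:R / Y) ^+ 2.
  move=> j1; apply: le_trans (hC j N Y j1 Y0).
  rewrite [leRHS](@big_cat_nat _ _ _ 2) //=; last by rewrite ltnS ltnW.
  apply: (@le_trans _ _ (\sum_(2 <= m < N.+1 | smooth_chained j m && (Y <= ln (m%:R : R))) m%:R^-1)); last first.
    by rewrite lerDr; apply: sumr_ge0 => m _; rewrite invr_ge0.
  rewrite [leLHS]big_mkcond [leRHS]big_mkcond; apply: ler_sum => m _ /=.
  case: ifP => [/andP[/andP[mB Ym] mj]|_]; last by case: ifP => // _; rewrite invr_ge0.
  rewrite ifT //; rewrite /smooth_chained mB Ym andbT /=.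
  have m_gt0 := chained_gt0 mB; rewrite /pnat m_gt0; apply/allP => q q_m.
  rewrite inE (leq_trans _ mj) ?andbT; last exact: max_pdiv_max.
  by move: q_m; rewrite mem_primes => /andP[/prime_gt0].
have split_ln m : (1 < m <= N)%N -> (ln (max_pdiv m)%:R)^-1
    = (ln N%:R)^-1 + \sum_(2 <= j < N | (max_pdiv m <= j)%N) D j.
  move=> /andP[m1 mN]; have P1 : (1 < max_pdiv m)%N by rewrite prime_gt1 // max_pdiv_prime.
  have PN : (max_pdiv m <= N)%N by rewrite (leq_trans _ mN) // max_pdiv_leq // ltnW.
  have := @big_nat_widenl R 0 +%R (max_pdiv m) 2 N xpredT D P1; rewrite /= => <-.
  rewrite (eq_bigr (fun j => - (ln j.+1%:R)^-1 - - (ln j%:R)^-1 : R)); last first.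
    by move=> j _; rewrite /D opprK addrC.
  by rewrite telescope_sumr // opprK addrA subrr add0r.
have EN : \sum_(2 <= m < N.+1 | chained m && (Y <= ln (m%:R : R))) m%:R^-1 * (ln (max_pdiv m)%:R)^-1
  = (ln N%:R)^-1 * \sum_(2 <= m < N.+1 | chained m && (Y <= ln (m%:R : R))) m%:R^-1
  + \sum_(2 <= j < N) D j *
     \sum_(2 <= m < N.+1 | chained m && (Y <= ln (m%:R : R)) && (max_pdiv m <= j)%N) m%:R^-1.
  under [X in _ = _ + X]eq_bigr => j _ do rewrite mulr_sumr.
  rewrite [X in _ = _ + X](exchange_big_dep (fun m => chained m && (Y <= ln (m%:R : R)))) /=; last first.
    by move=> j m _ /andP[].
  rewrite mulr_sumr -big_split /= big_nat_cond [RHS]big_nat_cond.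
  apply: eq_bigr => m /andP[m_bd mY]; rewrite split_ln // mY /= -mulr_suml; ring.
rewrite EN {EN}.
have LN := lnp N N1.
have part1 : (ln N%:R)^-1 * \sum_(2 <= m < N.+1 | chained m && (Y <= ln (m%:R : R))) m%:R^-1
    <= C * ln N%:R / Y ^+ 2.
  have := smooth_le N N1; rewrite (eq_bigl (fun m => [&& chained m, Y <= ln (m%:R : R) & (max_pdiv m <= N)%N])); last first.
    by move=> m; rewrite andbA.
  move=> h; rewrite -(ler_pM2l LN) mulrA mulfV ?gt_eqF // mul1r.
  have -> : ln N%:R * (C * ln N%:R / Y ^+ 2) = C * (ln N%:R / Y) ^+ 2 by field; lra.
  apply: le_trans h; rewrite [leLHS]big_nat_cond [leRHS]big_nat_cond le_eqVlt.
  apply/orP; left; apply/eqP; apply: eq_bigl => m.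
  case m_bd: (1 < m < N.+1)%N => //=; move: m_bd => /andP[m1 mN].
  have -> : (max_pdiv m <= N)%N by rewrite (leq_trans (max_pdiv_leq (ltnW m1))).
  by rewrite andbT.
have part2 : \sum_(2 <= j < N) D j *
     (\sum_(2 <= m < N.+1 | chained m && (Y <= ln (m%:R : R)) && (max_pdiv m <= j)%N) m%:R^-1)
    <= C * ln N%:R / Y ^+ 2.
  (* With [x = ln j] and [y = ln (j + 1)], [(1 / x - 1 / y) * x^2 = (y - x) * (x / y) <= y - x],
     which telescopes. *)
  apply: (@le_trans _ _ (\sum_(2 <= j < N) C / Y ^+ 2 * (ln j.+1%:R - ln j%:R))).
    rewrite !big_nat; apply: ler_sum => j /andP[j1 _].
    apply: (le_trans (ler_wpM2l (D0 j j1) (smooth_le j j1))).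
    have x0 := lnp j j1; have y0 := lnp j.+1 (ltnW j1).
    have xy : ln (j%:R : R) <= ln j.+1%:R by rewrite lnn_le // ltnW.
    rewrite /D; move: (ln (j%:R : R)) (ln (j.+1%:R : R)) x0 y0 xy => x y x0 y0 xy.
    have -> : (x^-1 - y^-1) * (C * (x / Y) ^+ 2) = C / Y ^+ 2 * ((y - x) * (x / y)).
      by field; rewrite !gt_eqF.
    apply: ler_wpM2l; first by rewrite divr_ge0 ?sqr_ge0 ?ltW.
    by rewrite ler_piMr ?subr_ge0 // ler_pdivrMr // mul1r.
  rewrite -mulr_sumr telescope_sumr //.
  have -> : C * ln N%:R / Y ^+ 2 = C / Y ^+ 2 * ln N%:R by rewrite mulrAC.
  apply: ler_wpM2l; first by rewrite divr_ge0 ?sqr_ge0 ?ltW.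
  by rewrite gerBl lnn_ge0.
have -> : 2 * C * ln N%:R / Y ^+ 2 = C * ln N%:R / Y ^+ 2 + C * ln N%:R / Y ^+ 2.
  by rewrite -!mulrA mulrA mulr_natl mulr2n mulrDl.
exact: lerD.
Qed.

Lemma count_nat_le (R : realType) (M : nat) (x : R) : 0 <= x ->
  \sum_(1 <= n < M.+1 | n%:R <= x) (1 : R) <= x.
Proof.
move=> x0; elim: M => [|M IH]; first by rewrite big_geq.
rewrite big_mkcond big_nat_recr //= -big_mkcond /=; case: ifP => [hM|_]; last by rewrite addr0.
apply: le_trans hM; rewrite -natr1 lerD2r big_mkcond.
apply: (@le_trans _ _ (\sum_(1 <= n < M.+1) 1)).
  by apply: ler_sum => n _; case: ifP.
by rewrite big_const_nat subn1 iter_addr addr0.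
Qed.

(** The chain condition at the largest prime gives [p <= m + 2 <= 3 * m], so [n <= 3 * m^2] and
    [N < n^2 <= 9 * m^4]; this also rules out [m = 1]. *)
Lemma chained_quotient (n N : nat) : chained n -> (80 < N)%N -> (N < n ^ 2)%N ->
  let p := max_pdiv n in let m := (n %/ p)%N in
  [/\ prime p, n = (m * p)%N, chained m, (1 < m)%N & (max_pdiv m <= p)%N /\ (N < 9 * m ^ 4)%N].
Proof.
move=> nB N80 Nn p m; have n0 := chained_gt0 nB.
have n1 : (1 < n)%N by case: n nB Nn n0 {p m} => [|[|n]] // _; rewrite exp1n; lia.
have p_pr : prime p by apply: max_pdiv_prime.
have En : n = (m * p)%N by rewrite divnK // max_pdiv_dvd.
have m0 : (0 < m)%N by move: n0; rewrite En muln_gt0 => /andP[].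
have m_p : (below p.+1).-nat m.
  rewrite /pnat m0; apply/allP => q; rewrite mem_primes inE ltnS => /and3P[q_pr _ qm].
  by apply: max_pdiv_max; rewrite mem_primes q_pr n0 /= En dvdn_mulr.
have [mB pm] : chained m /\ (p <= m.+2)%N.
  by apply: chained_mulr_prime p_pr m_p _; rewrite -En.
have Nm : (N < 9 * m ^ 4)%N.
  apply: (leq_trans Nn); rewrite En.
  have h : (m * p <= 3 * (m * m))%N.
    by rewrite mulnCA leq_mul2l; apply/orP; right; lia.
  by rewrite -(mulnn (m * p)) (leq_trans (leq_mul h h)) //; lia.
have m1 : (1 < m)%N by case: (m) m0 Nm => [|[|k]] // _; rewrite exp1n; lia.
split=> //; split=> //; rewrite -ltnS; apply: (pnat_prime_in m_p).
  exact: max_pdiv_prime.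
exact: max_pdiv_dvd.
Qed.

Lemma chained_count_sqrt (R : realType) : exists2 C : R, 0 < C & forall N : nat, (80 < N)%N ->
  \sum_(1 <= n < N.+1 | chained n && (N < n ^ 2)%N) (1 : R) <= C * (N%:R / ln N%:R).
Proof.
have [C C0 hC] := sum_inv_ln_max_pdiv R; exists (3 * 64 * C) => [|N N80]; first by lra.
have N1 : (1 < N)%N by apply: leq_trans N80.
have LN : 0 < ln (N%:R : R) by rewrite ln_gt0 // ltr1n.
set L := ln N%:R in LN *; pose Y := L / 8; have Y0 : 0 < Y by rewrite divr_gt0.
pose K m := chained m && (Y <= ln (m%:R : R)).
(* At [k = p], the largest prime of [n = m * p], the weight [ln p / ln P(m)] is at least [1]; summed
   over primes [k <= N / m] it is controlled by Chebyshev's bound. *)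
pose F m k : R := (if prime k then ln k%:R else 0) * (ln (max_pdiv m)%:R)^-1.
have F0 m k : 0 <= F m k.
  by rewrite mulr_ge0 ?invr_ge0 ?lnn_ge0 //; case: ifP => // _; apply: lnn_ge0.
have step1 : \sum_(1 <= n < N.+1 | chained n && (N < n ^ 2)%N) (1 : R)
  <= \sum_(1 <= n < N.+1) \sum_(2 <= m < N.+1 | K m && (m %| n)%N) F m (n %/ m)%N.
  rewrite big_mkcond /= big_nat [leRHS]big_nat; apply: ler_sum => n /andP[n0 nN].
  case: ifP => [/andP[nB Nn]|_]; last by apply: sumr_ge0.
  have [p_pr En mB m1 [Pp Nm]] := chained_quotient nB N80 Nn.
  set p := max_pdiv n in p_pr En mB m1 Pp Nm; set m := (n %/ p)%N in En mB m1 Pp Nm.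
  have m0 := ltnW m1; have mn : (m %| n)%N by rewrite En dvdn_mulr.
  have m_in : m \in index_iota 2 N.+1.
    by rewrite mem_index_iota m1 (leq_ltn_trans _ nN) // dvdn_leq.
  have Km : K m.
    rewrite /K mB /= /Y.
    (* This is where [N > 80] enters: [ln 9 <= L / 2] turns [L <= ln 9 + 4 * ln m] into
       [ln m >= L / 8 = Y]. *)
    have lN2 : 2 * ln (9 : R) <= L.
      have -> : 2 * ln (9 : R) = ln 81%:R.
        by rewrite (_ : 81%:R = 9 * 9 :> R) ?lnM ?posrE //; lra.
      by apply: lnn_le.
    have : L <= ln (9 : R) + 4 * ln m%:R.
      have -> : ln (9 : R) + 4 * ln m%:R = ln (9 * m ^ 4)%N%:R.
        rewrite natrM natrX lnM ?posrE ?exprn_gt0 ?ltr0n // lnXn ?ltr0n //.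
        by rewrite -[X in _ = _ + X]mulr_natl.
      by apply: lnn_le => //; [exact: ltnW|exact: ltnW].
    lra.
  rewrite big_mkcond (bigD1_seq m) ?iota_uniq //= Km mn /=.
  have -> : (n %/ m)%N = p by rewrite {1}En mulKn.
  rewrite -[1]addr0 lerD //; last by apply: sumr_ge0 => i _; case: ifP.
  have P1 : (1 < max_pdiv m)%N by rewrite prime_gt1 // max_pdiv_prime.
  have lP : 0 < ln ((max_pdiv m)%:R : R) by rewrite ln_gt0 // ltr1n.
  by rewrite /F p_pr (ler_pdivlMr _ _ lP) mul1r; apply: lnn_le Pp; apply: ltnW.
apply: (le_trans step1); rewrite (exchange_big_dep K) /=; last by move=> n m _ /andP[].
apply: (@le_trans _ _ (3 * N%:R * \sum_(2 <= m < N.+1 | K m) m%:R^-1 * (ln (max_pdiv m)%:R)^-1)).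
  rewrite mulr_sumr big_nat_cond [leRHS]big_nat_cond; apply: ler_sum => m /andP[/andP[m1 _] Km].
  have m0 := ltnW m1.
  rewrite (eq_bigl (fun n => (m %| n)%N && xpredT n)); last by move=> n; rewrite Km andbT.
  rewrite (@sum_multiples R m N xpredT (fun n => F m (n %/ m)%N)) //.
  under eq_bigr => k _ do rewrite mulKn //.
  rewrite -mulr_suml -big_mkcond [leRHS]mulrA; apply: ler_wpM2r; first by rewrite invr_ge0 lnn_ge0.
  apply: (le_trans (theta_le R _)); rewrite -mulrA ler_wpM2l //.
  by rewrite ler_pdivlMr ?ltr0n // -natrM ler_nat leq_trunc_div.
have N30 : 0 <= 3 * N%:R :> R by rewrite mulr_ge0.
apply: (le_trans (ler_wpM2l N30 (hC N Y N1 Y0))); rewrite -/L /Y le_eqVlt.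
by apply/orP; left; apply/eqP; field; lra.
Qed.

Lemma chained_count (R : realType) : exists2 C : R, 0 < C & forall N : nat, (1 < N)%N ->
  \sum_(1 <= n < N.+1 | chained n) (1 : R) <= C * (N%:R / ln N%:R).
Proof.
have [C C0 hC] := chained_count_sqrt R; exists (80 + C) => [|N N1]; first by lra.
have LN : 0 < ln (N%:R : R) by rewrite ln_gt0 // ltr1n.
have NL0 : 0 <= N%:R / ln N%:R :> R by rewrite divr_ge0 ?(ltW LN).
have Npos : 0 < N%:R :> R by rewrite ltr0n ltnW.
(* The constant [80] serves twice: for [N <= 80] it bounds [ln N], and for larger [N] it absorbs the
   [n <= sqrt N], since [sqrt N * ln N <= 2 * N]. *)
have [N80|N80] := leqP N 80.
  apply: (@le_trans _ _ N%:R).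
    apply: (@le_trans _ _ (\sum_(1 <= n < N.+1) 1)).
      by rewrite big_mkcond; apply: ler_sum => n _; case: ifP.
    by rewrite big_const_nat subn1 iter_addr addr0.
  have l80 : ln (N%:R : R) <= 80.
    have N80R : N%:R <= 80 :> R by rewrite (ler_nat R N 80).
    by apply: le_trans (ln_le_subr1 Npos) _; lra.
  rewrite mulrA ler_pdivlMr // mulrC; apply: ler_wpM2r; lra.
rewrite (bigID (fun n => N < n ^ 2)%N) /= mulrDl addrC; apply: lerD; last exact: hC.
apply: (@le_trans _ _ (Num.sqrt N%:R)).
  have := @count_nat_le R N (Num.sqrt N%:R) (sqrtr_ge0 _); apply: le_trans.
  rewrite [leLHS]big_mkcond [leRHS]big_mkcond; apply: ler_sum => n _ /=.
  case: ifP => [/andP[_]|_]; last by case: ifP.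
  rewrite -leqNgt => le_n; rewrite ifT //.
  by rewrite -[n%:R]ger0_norm // -sqrtr_sqr ler_sqrt // -natrX ler_nat.
have s0 : 0 < Num.sqrt (N%:R : R) by rewrite sqrtr_gt0.
have Es := sqr_sqrtr (ltW Npos).
have h : ln (N%:R : R) <= 2 * Num.sqrt N%:R.
  rewrite -[in leLHS]Es lnXn // -[leLHS]mulr_natl ler_wpM2l //.
  by apply: le_trans (ln_le_subr1 s0) _; lra.
rewrite mulrA ler_pdivlMr // -[N%:R in leRHS]Es.
have := ler_wpM2l (ltW s0) h; have := sqr_ge0 (Num.sqrt (N%:R : R)).
by move: (Num.sqrt (N%:R : R)) (ln (N%:R : R)) => s l; lra.
Qed.

(* The counting set {n <= X : n lambda*-practical} is finite; we count it as
   the cardinality of a finite set of nats lying in {0, ..., truncn X}. *)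
Theorem theorem5p7 (R : realType) :
  exists u : R, 0 < u /\
    forall X : R, 2 <= X ->
      (#|[set n : 'I_(Num.truncn X).+1 |
           `[< lambda_star_practical n >] && ((n : nat)%:R <= X)]|%:R : R)
        <= u * (X / ln X).
Proof.
have [C C0 hC] := chained_count R; exists (2 * C); split=> [|X X2]; first by lra.
have X0 : 0 <= X by lra.
have /andP[NX XN] := truncn_itv X0; set N := Num.truncn X in NX XN *.
have N1 : (1 < N)%N by rewrite -ltnS -(ltr_nat R); apply: le_lt_trans XN.
have LN : 0 < ln (N%:R : R) by rewrite ln_gt0 // ltr1n.
have Xp : 0 < X by lra.
(* From [X < N + 1 <= N^2]; replacing [ln N] by [ln X] costs the factor [2] in the constant. *)
have LX : ln X <= 2 * ln (N%:R : R).
  apply: (@le_trans _ _ (ln (N%:R ^+ 2))); last first.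
    by rewrite lnXn ?ltr0n ?(ltnW N1) // -[leLHS]mulr_natl.
  rewrite ler_ln ?posrE ?exprn_gt0 ?ltr0n ?(ltnW N1) //; apply: le_trans (ltW XN) _.
  by rewrite -natrX ler_nat -mulnn -(addn1 N); nia.
have LX0 : 0 < ln X by rewrite ln_gt0; lra.
apply: (@le_trans _ _ (C * (N%:R / ln N%:R))); last first.
  rewrite (mulrC 2) -mulrA; apply: ler_wpM2l; first exact: ltW.
  rewrite ler_pdivrMr // mulrA mulrAC ler_pdivlMr //.
  by rewrite [leLHS]mulrC [leRHS]mulrAC; apply: ler_pM => //; exact: ltW.
apply: le_trans (hC N N1); rewrite -sum1_card natr_sum.
(* The ordinal [0] is split off: it contributes nothing, since a practical number is positive. The
   others are shifted to [i.+1]. *)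
rewrite big_mkcond /= (big_ord_recl N).
apply: (@le_trans _ _ (\sum_(0 <= i < N) if chained i.+1 then 1 else 0)); last first.
  by rewrite [leRHS]big_mkcond big_add1.
rewrite big_mkord /= ifF ?add0r.
  apply: ler_sum => i _; case: ifP => [|_]; last by case: ifP.
  by rewrite inE => /andP[/asboolP/practical_chained /= -> _].
by apply/negbTE; rewrite inE /=; apply/negP => /andP[/asboolP[]].
Qed.
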